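(* Let $A,C,\eta,N_0$ and $u_0$, $u_0^N$ be as in the context. For each integer $N>N_0$ let $(q_0,\dots,q_N)$ be the solution of the linear ODE system $$\dot q_k=a_{k-1}q_{k-1}-(a_k+c_k)q_k+c_{k+1}q_{k+1},\qquad k=0,\dots,N,$$ where $a_k=N A(k/N)$ and $c_k=N C(k/N)$ for $0\le k\le N$ and $a_{-1}=c_{N+1}=0$ (the corresponding terms are absent), with initial conditions $q_k(0)=u_0(k/N)$ for $k=0,1,\dots,N$. Let $u^N$ be the solution of the Fokker-Planck equation $$\partial_t u(t,z)=\frac1{2N}\partial_{zz}\big((A(z)+C(z))u(t,z)\big)-\partial_z\big((A(z)-C(z))u(t,z)\big),\qquad z\in[-h,1+h],$$ subject to the boundary conditions $$\frac1{2N}\partial_z((A+C)u)(t,z)-((A-C)u)(t,z)=0\quad\text{for } z=-h \text{ and } z=1+h,$$ and the initial condition $u^N(0,\cdot)=u_0^N$. Then for any $t_0>0$ there exists a constant $K$, independent of $N$, such that $$\left|u^N\!\left(t,\tfrac kN\right)-q_k(t)\right|\le K\qquad\text{for all } t\in[0,t_0],\ k=0,1,\dots,N,\ N>N_0 .$$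
   Context: Let $\eta>0$ and let $A,C\in C^4[-\eta,1+\eta]$ be real-valued functions, non-negative on $[0,1]$, with $A+C>0$ on $[-\eta,1+\eta]$, $A(1)=C(0)=0$, $A-C>0$ on $[-\eta,0]$ and $A-C<0$ on $[1,1+\eta]$. Let $N_0>1/(2\eta)$ be a positive integer such that $2N_0|A(x)-C(x)|>|A'(x)+C'(x)|$ for all $x\in[-\eta,0]\cup[1,1+\eta]$. For each $N$ put $h=\frac1{2N}$. Let $u_0\in C^2[0,1]$ be a non-negative function with $u_0(0)=u_0'(0)=u_0(1)=u_0'(1)=0$, such that its extension $u_0^N$ to $[-h,1+h]$ by the constant $0$ outside $[0,1]$ belongs to $C^2[-h,1+h]$. The solution of the Fokker-Planck equation is understood as $u^N(t,\cdot)=S_N(t)u_0^N$, where $(S_N(t))_{t\ge0}$ is the (analytic, strongly continuous) semigroup on $C[-h,1+h]$ (complex-valued functions, sup norm) generated by $\mathcal A_N f=\frac1{2N}((A+C)f)''-((A-C)f)'$ with domain $D(\mathcal A_N)=\{f\in C^2[-h,1+h]: \frac1{2N}((A+C)f)'(z)-((A-C)f)(z)=0 \text{ for } z=-h,\,1+h\}$. *)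

(* Defs.v *)
From Stdlib Require Import Reals.
From Coquelicot Require Import Coquelicot.
Open Scope R_scope.

Definition Icc (a b : R) : R -> Prop := fun x => a <= x <= b.

(* Coquelicot's [is_derive], with the neighbourhood filter of [x] restricted to
   [D]: on a closed interval this is the one-sided derivative at an end-point,
   and the values of [f] outside [D] play no role. *)
Definition is_derive_on {V : NormedModule R_AbsRing}
    (D : R -> Prop) (f : R -> V) (x : R) (l : V) : Prop :=
  filterdiff (U := AbsRing_NormedModule R_AbsRing)
    f (within D (locally x)) (fun y : R => scal y l).

(* Meaningful only where the derivative exists. *)
Definition Derive_on {V : CompleteNormedModule R_AbsRing}
    (D : R -> Prop) (f : R -> V) (x : R) : V :=
  iota (is_derive_on D f x).

Fixpoint class_C {V : NormedModule R_AbsRing}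
    (n : nat) (D : R -> Prop) (f : R -> V) : Prop :=
  match n with
  | O => continuous_on D f
  | S m => exists f' : R -> V,
      (forall x, D x -> is_derive_on D f x (f' x)) /\ class_C m D f'
  end.

Definition RDerive_on : (R -> Prop) -> (R -> R) -> R -> R :=
  @Derive_on R_CompleteNormedModule.
Definition CDerive_on : (R -> Prop) -> (R -> C) -> R -> C :=
  @Derive_on C_R_CompleteNormedModule.
Definition Rclass_C : nat -> (R -> Prop) -> (R -> R) -> Prop :=
  @class_C R_NormedModule.
Definition Cclass_C : nat -> (R -> Prop) -> (R -> C) -> Prop :=
  @class_C C_R_NormedModule.

(* An element of the Banach space C(I) of complex continuous functions on [I]
   is represented by any [f : cfun] with [inCI I f]; two representatives denote
   the same element iff they agree on [I]. *)
Definition cfun := R -> C.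

Definition inCI (I : R -> Prop) (f : cfun) : Prop := Cclass_C 0 I f.

Definition eqCI (I : R -> Prop) (f g : cfun) : Prop :=
  forall x, I x -> f x = g x.

Definition leCI (I : R -> Prop) (f : cfun) (B : R) : Prop :=
  forall x, I x -> Cmod (f x) <= B.

(* Convergence F(t) -> g as t -> 0+ in the sup norm over [I]. *)
Definition sup_lim0 (I : R -> Prop) (F : R -> cfun) (g : cfun) : Prop :=
  forall eps : R, 0 < eps ->
    at_right 0 (fun t => leCI I (fun x => F t x - g x)%C eps).

Record C0_semigroup (I : R -> Prop) (T : R -> cfun -> cfun) : Prop := {
  sg_closed : forall t f, 0 <= t -> inCI I f -> inCI I (T t f);
  sg_ext : forall t f g, 0 <= t -> inCI I f -> inCI I g ->
    eqCI I f g -> eqCI I (T t f) (T t g);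
  sg_linear : forall t (a b : C) f g, 0 <= t -> inCI I f -> inCI I g ->
    eqCI I (T t (fun x => a * f x + b * g x)%C)
           (fun x => a * T t f x + b * T t g x)%C;
  sg_bounded : forall t, 0 <= t -> exists M : R, forall f (B : R),
    inCI I f -> leCI I f B -> leCI I (T t f) (M * B);
  sg_zero : forall f, inCI I f -> eqCI I (T 0 f) f;
  sg_add : forall s t f, 0 <= s -> 0 <= t -> inCI I f ->
    eqCI I (T (s + t) f) (T s (T t f));
  sg_cont : forall f, inCI I f -> sup_lim0 I (fun t => T t f) f
}.

(* (f, g) belongs to the graph of the infinitesimal generator of T. *)
Definition generator (I : R -> Prop) (T : R -> cfun -> cfun) (f g : cfun) :
    Prop :=
  inCI I f /\ inCI I g /\
  sup_lim0 I (fun t x => (T t f x - f x) / RtoC t)%C g.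

Definition half_step (N : nat) : R := 1 / (2 * INR N).

Definition INh (N : nat) : R -> Prop := Icc (- half_step N) (1 + half_step N).

(* The coefficient written C in the mathematics is called [Cf], as [C] is the
   type of complex numbers. *)
Definition sumf (A Cf : R -> R) (f : cfun) : cfun :=
  fun x => (RtoC (A x + Cf x) * f x)%C.
Definition difff (A Cf : R -> R) (f : cfun) : cfun :=
  fun x => (RtoC (A x - Cf x) * f x)%C.

Definition FP_op (A Cf : R -> R) (N : nat) (f : cfun) : cfun :=
  fun x =>
    (RtoC (1 / (2 * INR N)) *
       CDerive_on (INh N) (CDerive_on (INh N) (sumf A Cf f)) x
     - CDerive_on (INh N) (difff A Cf f) x)%C.

Definition FP_dom (A Cf : R -> R) (N : nat) (f : cfun) : Prop :=
  Cclass_C 2 (INh N) f /\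
  forall z : R, z = - half_step N \/ z = 1 + half_step N ->
    (RtoC (1 / (2 * INR N)) * CDerive_on (INh N) (sumf A Cf f) z
     - difff A Cf f z = RtoC 0)%C.

(* The generator of T is required to equal FP_op, domain included. *)
Definition FP_semigroup (A Cf : R -> R) (N : nat) (T : R -> cfun -> cfun) :
    Prop :=
  C0_semigroup (INh N) T /\
  forall f g : cfun,
    generator (INh N) T f g <->
    FP_dom A Cf N f /\ eqCI (INh N) g (FP_op A Cf N f).

Definition ext0 (u : R -> R) : R -> R :=
  fun x => if Rle_dec 0 x then if Rle_dec x 1 then u x else 0 else 0.

Definition rate (F : R -> R) (N k : nat) : R := INR N * F (INR k / INR N).

Definition master_rhs (A Cf : R -> R) (N : nat) (q : nat -> R) (k : nat) : R :=
  (match k with O => 0 | S j => rate A N j * q j end)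
  - (rate A N k + rate Cf N k) * q k
  + (if Nat.ltb k N then rate Cf N (S k) * q (S k) else 0).

Definition master_solution (A Cf : R -> R) (N : nat) (u0 : R -> R)
    (q : nat -> R -> R) : Prop :=
  (forall k : nat, (k <= N)%nat -> q k 0 = u0 (INR k / INR N)) /\
  forall (k : nat) (t : R), (k <= N)%nat -> 0 <= t ->
    is_derive_on (fun s => 0 <= s) (q k) t
      (master_rhs A Cf N (fun j => q j t) k).

(* Main.v *)
Require Import Defs.
From Stdlib Require Import Reals Lra Lia Psatz Classical IndefiniteDescription.
From Coquelicot Require Import Coquelicot.
Open Scope R_scope.

(* Both [u^N] and [q] are bounded on [[0, t0]] uniformly in [N], so their
   difference is.

   For [q], the row sums [a_(k-1) - (a_k + c_k) + c_(k+1)] of the master equation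
   are at most [2 L], with [L] a common Lipschitz constant of [A] and [C]; hence
   [exp (- (2 L + 1) t) q_k(t)] cannot have a positive maximum over [k] and [t]
   at a time [t > 0].

   For [u^N], a maximum principle: at a maximum point of [|v|], the boundary
   condition together with the hypothesis on [N0] excludes the end-points, and in
   the interior only the zeroth order coefficient [(A+C)''/(2N) - (A-C)'] of the
   operator survives.  The generator is therefore quasi-dissipative with a
   constant independent of [N].  Local boundedness of the semigroup (uniform
   boundedness principle) then makes backward Euler steps from [u_0^N], which lies
   in the domain, accurate enough to bound the orbit. *)

Local Notation rd := (is_derive_on (V := R_NormedModule)).
Local Notation cd := (is_derive_on (V := C_R_NormedModule)).

(** * Derivatives within a set *)

(** [filterdiff] asks for an estimate at every limit of the filter. Since [x] lies in [D], every
    property that holds eventually holds at [x] itself, so no other point can be a limit. *)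
Lemma is_filter_lim_within (D : R -> Prop) (x z : R) :
  D x -> is_filter_lim (T := AbsRing_NormedModule R_AbsRing) (within D (locally x)) z -> z = x.
Proof.
  intros Dx H.
  destruct (Req_dec z x) as [e|n]; [exact e|exfalso].
  assert (e : 0 < Rabs (x - z)) by (apply Rabs_pos_lt; lra).
  assert (HP : locally z (fun y => Rabs (y - z) < Rabs (x - z))).
  { exists (mkposreal _ e); intros y Hy; exact Hy. }
  specialize (H _ HP); unfold within in H.
  apply locally_singleton in H.
  specialize (H Dx); lra.
Qed.

Lemma within_is_filter_lim (D : R -> Prop) (x : R) :
  is_filter_lim (T := AbsRing_NormedModule R_AbsRing) (within D (locally x)) x.
Proof.
  intros P HP; unfold within.
  apply (filter_imp P); [auto|exact HP].
Qed.

Lemma within_ProperFilter (D : R -> Prop) (x : R) :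
  D x -> ProperFilter (within D (locally x)).
Proof.
  intros Dx; split; [|apply within_filter; apply locally_filter].
  intros P HP; exists x.
  exact (locally_singleton _ _ HP Dx).
Qed.

(** The epsilon-delta form in which the estimates below use the derivative, free of filters. *)
Lemma is_derive_on_eps (D : R -> Prop) (f : R -> R) (x l : R) :
  D x ->
  is_derive_on (V := R_NormedModule) D f x l <->
  forall eps, 0 < eps -> exists d, 0 < d /\ forall y, D y -> Rabs (y - x) < d ->
    Rabs (f y - f x - l * (y - x)) <= eps * Rabs (y - x).
Proof.
  intros Dx; split.
  - intros [_ H] eps Heps.
    destruct (H x (within_is_filter_lim D x) (mkposreal eps Heps)) as [d Hd].
    exists d; split; [apply cond_pos|].
    intros y Dy Hy.
    generalize (Hd y Hy Dy).
    change (Rabs ((f y + - f x) + - ((y + - x) * l)) <= eps * Rabs (y + - x) ->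
      Rabs (f y - f x - l * (y - x)) <= eps * Rabs (y - x)).
    replace ((f y + - f x) + - ((y + - x) * l)) with (f y - f x - l * (y - x)) by ring.
    auto.
  - intros H; split; [apply (is_linear_scal_l (V := R_NormedModule) l)|].
    intros z Hz; rewrite (is_filter_lim_within D x z Dx Hz); clear z Hz.
    intros eps.
    destruct (H eps (cond_pos eps)) as [d [d0 Hd]].
    exists (mkposreal d d0); intros y Hy Dy.
    change (Rabs ((f y + - f x) + - ((y + - x) * l)) <= eps * Rabs (y + - x)).
    replace ((f y + - f x) + - ((y + - x) * l)) with (f y - f x - l * (y - x)) by ring.
    apply (Hd y Dy Hy).
Qed.

(** Projections and pairing are linear, hence compose with differentials. Complex derivatives
    thereby reduce to real ones. *)
Lemma is_derive_on_C (D : R -> Prop) (f : R -> C) (x : R) (l : C) :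
  is_derive_on (V := C_R_NormedModule) D f x l <->
  is_derive_on (V := R_NormedModule) D (fun y => fst (f y)) x (fst l) /\
  is_derive_on (V := R_NormedModule) D (fun y => snd (f y)) x (snd l).
Proof.
  split.
  - intros H; split.
    + refine (filterdiff_comp (V := C_R_NormedModule) (W := R_NormedModule)
        f fst _ fst H (filterdiff_linear _ _)).
      exact (is_linear_fst (U := R_NormedModule) (V := R_NormedModule)).
    + refine (filterdiff_comp (V := C_R_NormedModule) (W := R_NormedModule)
        f snd _ snd H (filterdiff_linear _ _)).
      exact (is_linear_snd (U := R_NormedModule) (V := R_NormedModule)).
  - intros [H1 H2].
    generalize (filterdiff_comp_2 (U := R_NormedModule) (V := R_NormedModule)
      (W := C_R_NormedModule) _ _ (fun a b => (a, b)) _ _ (fun a b => (a, b)) H1 H2).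
    intros H; unfold is_derive_on.
    apply (filterdiff_ext_loc _ _ _) with (3 := H (filterdiff_linear _
       (is_linear_prod _ _ (is_linear_fst (U := R_NormedModule) (V := R_NormedModule))
         (is_linear_snd (U := R_NormedModule) (V := R_NormedModule))))).
    + apply filter_forall; intros y; symmetry; apply surjective_pairing.
    + intros y _; symmetry; apply surjective_pairing.
Qed.

Lemma is_derive_on_ext {V : NormedModule R_AbsRing} (D : R -> Prop) (f g : R -> V) x l :
  D x -> (forall y, D y -> f y = g y) -> is_derive_on D f x l -> is_derive_on D g x l.
Proof.
  intros Dx E H.
  apply (filterdiff_ext_loc _ _ _) with (3 := H).
  - apply (filter_forall (F := locally x)); exact E.
  - intros z Hz; rewrite (is_filter_lim_within D x z Dx Hz); auto.
Qed.

Lemma is_derive_on_continuous {V : NormedModule R_AbsRing} (D : R -> Prop) (f : R -> V) x l :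
  is_derive_on D f x l -> filterlim f (within D (locally x)) (locally (f x)).
Proof.
  intros H.
  apply (filterdiff_continuous_aux (U := AbsRing_NormedModule R_AbsRing) (F := within D (locally x)) f
    (ex_intro _ (fun y : R => scal y l) H) x (within_is_filter_lim D x)).
Qed.

Lemma class_C_continuous {V : NormedModule R_AbsRing} n (D : R -> Prop) (f : R -> V) :
  class_C n D f -> continuous_on D f.
Proof.
  destruct n as [|n]; [auto|].
  intros [f' [H _]] x Dx; apply (is_derive_on_continuous _ _ _ _ (H x Dx)).
Qed.

Lemma is_derive_on_subset (D E : R -> Prop) (f : R -> R) x l :
  (forall y, E y -> D y) -> E x -> rd D f x l -> rd E f x l.
Proof.
  intros HS Ex H; apply is_derive_on_eps; [exact Ex|].
  intros eps Heps.
  destruct (proj1 (is_derive_on_eps D f x l (HS x Ex)) H eps Heps) as [d [d0 Hd]].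
  exists d; split; [exact d0|]; auto.
Qed.

Lemma is_derive_on_interior (D : R -> Prop) (f : R -> R) x l :
  locally x D -> rd D f x l -> is_derive f x l.
Proof.
  intros HD H.
  assert (Dx := locally_singleton _ _ HD).
  split; [apply (is_linear_scal_l (V := R_NormedModule) l)|].
  intros z Hz.
  assert (E : z = x) by (symmetry; apply (is_filter_lim_locally_unique x z Hz)).
  rewrite E.
  intros eps.
  generalize (proj2 H x (within_is_filter_lim D x) eps); unfold within; intros K.
  generalize (filter_and _ _ HD K); apply filter_imp; intros y [a b]; auto.
Qed.

Lemma is_derive_is_derive_on (D : R -> Prop) (f : R -> R) x l :
  D x -> is_derive f x l -> rd D f x l.
Proof.
  intros Dx H.
  exact (@filterdiff_locally R_AbsRing (AbsRing_NormedModule R_AbsRing) R_NormedModule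
    _ (within_ProperFilter D x Dx) f x _ (within_is_filter_lim D x) H).
Qed.

Lemma is_derive_on_mult (D : R -> Prop) (f g : R -> R) x lf lg :
  D x -> rd D f x lf -> rd D g x lg ->
  rd D (fun y => f y * g y) x (lf * g x + f x * lg).
Proof.
  intros Dx Hf Hg.
  assert (PF := within_ProperFilter D x Dx).
  (* The product rule is invoked along the image of the filter under [(f, g)]; that this image tends
     to [(f x, g x)] is the continuity of both factors within [D]. *)
  assert (L : is_filter_lim (T := prod_UniformSpace R_UniformSpace R_UniformSpace)
     (filtermap (fun t => (f t, g t)) (within D (locally x))) (f x, g x)).
  { intros P [e He].
    unfold filtermap.
    assert (A := proj1 (filterlim_locally _ _) (is_derive_on_continuous _ _ _ _ Hf) e).
    assert (B := proj1 (filterlim_locally _ _) (is_derive_on_continuous _ _ _ _ Hg) e).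
    generalize (filter_and _ _ A B); apply filter_imp; intros y [a b].
    apply He; split; [exact a|exact b]. }
  generalize (filterdiff_comp_2 (U := R_NormedModule) (V := R_NormedModule)
      (W := R_NormedModule) _ _ (fun a b => mult a b) _ _ 
      (fun a b => plus (mult a (g x)) (mult (f x) b)) Hf Hg
      (filterdiff_mult (K := R_AbsRing) (f x, g x) L Rmult_comm)).
  intros H; apply (filterdiff_ext_lin _ _ _ H).
  intros y; unfold plus, mult, scal; simpl; unfold mult; simpl; ring.
Qed.

Lemma is_derive_on_plus (D : R -> Prop) (f g : R -> R) x lf lg :
  rd D f x lf -> rd D g x lg -> rd D (fun y => f y + g y) x (lf + lg).
Proof.
  intros Hf Hg.
  generalize (filterdiff_plus_fct (V := R_NormedModule) _ _ _ _ Hf Hg).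
  intros H; apply (filterdiff_ext_lin _ _ _ H).
  intros y; unfold plus, scal; simpl; unfold mult; simpl; ring.
Qed.

Lemma is_derive_on_const (D : R -> Prop) (c x : R) : rd D (fun _ => c) x 0.
Proof.
  generalize (filterdiff_const (U := AbsRing_NormedModule R_AbsRing) (V := R_NormedModule)
    (F := within D (locally x)) c).
  intros H; apply (filterdiff_ext_lin _ _ _ H).
  intros y; unfold zero, scal; simpl; unfold mult; simpl; ring.
Qed.

Lemma is_derive_on_scal (D : R -> Prop) (f : R -> R) c x l :
  D x -> rd D f x l -> rd D (fun y => c * f y) x (c * l).
Proof.
  intros Dx H.
  replace (c * l) with (0 * f x + c * l) by ring.
  apply (is_derive_on_mult D (fun _ => c) f); auto using is_derive_on_const.
Qed.

(** * Uniqueness of derivatives on a non-degenerate interval *)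

Lemma Icc_accumulation a b x d : a < b -> Icc a b x -> 0 < d ->
  exists y, Icc a b y /\ y <> x /\ Rabs (y - x) < d.
Proof.
  unfold Icc; intros ab [ax xb] d0.
  destruct (Rlt_dec x b) as [H|H].
  - exists (x + Rmin (d/2) (b - x)).
    assert (0 < Rmin (d/2) (b-x)) by (apply Rmin_pos; lra).
    assert (Rmin (d/2) (b-x) <= b - x) by apply Rmin_r.
    assert (Rmin (d/2) (b-x) <= d/2) by apply Rmin_l.
    repeat split; try lra.
    rewrite Rabs_pos_eq; lra.
  - exists (x - Rmin (d/2) (x - a)).
    assert (0 < Rmin (d/2) (x-a)) by (apply Rmin_pos; lra).
    assert (Rmin (d/2) (x-a) <= x - a) by apply Rmin_r.
    assert (Rmin (d/2) (x-a) <= d/2) by apply Rmin_l.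
    repeat split; try lra.
    rewrite Rabs_left; lra.
Qed.

(** Comparing two slopes requires a point of the interval near [x] but different from it, hence
    [a < b]. The tolerance is a quarter of the gap and is spent twice, which would bound the gap by
    half of itself. *)
Lemma is_derive_on_unique a b f x l l' :
  a < b -> Icc a b x -> rd (Icc a b) f x l -> rd (Icc a b) f x l' -> l = l'.
Proof.
  intros ab Ix H H'.
  destruct (Req_dec l l') as [E|N]; [exact E|exfalso].
  assert (P : 0 < Rabs (l - l')) by (apply Rabs_pos_lt; lra).
  destruct (proj1 (is_derive_on_eps _ f x l Ix) H (Rabs (l - l') / 4)) as [d [d0 Hd]]; [lra|].
  destruct (proj1 (is_derive_on_eps _ f x l' Ix) H' (Rabs (l - l') / 4)) as [d' [d0' Hd']]; [lra|].
  destruct (Icc_accumulation a b x (Rmin d d') ab Ix) as [y [Iy [ny Hy]]].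
  { apply Rmin_pos; auto. }
  specialize (Hd y Iy (Rlt_le_trans _ _ _ Hy (Rmin_l _ _))).
  specialize (Hd' y Iy (Rlt_le_trans _ _ _ Hy (Rmin_r _ _))).
  assert (Q : 0 < Rabs (y - x)) by (apply Rabs_pos_lt; lra).
  assert (Rabs ((l - l') * (y - x)) <= Rabs (l - l') / 4 * Rabs (y - x) + Rabs (l - l') / 4 * Rabs (y - x)).
  { replace ((l - l') * (y - x)) with ((f y - f x - l' * (y - x)) - (f y - f x - l * (y - x))) by ring.
    unfold Rminus at 1; eapply Rle_trans; [apply Rabs_triang|].
    rewrite Rabs_Ropp; lra. }
  rewrite Rabs_mult in H0.
  nra.
Qed.

Lemma is_derive_on_C_unique a b f x l l' :
  a < b -> Icc a b x -> cd (Icc a b) f x l -> cd (Icc a b) f x l' -> l = l'.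
Proof.
  intros ab Ix H H'.
  apply is_derive_on_C in H; apply is_derive_on_C in H'.
  destruct H as [H1 H2], H' as [H1' H2'].
  rewrite (surjective_pairing l), (surjective_pairing l').
  f_equal; eapply is_derive_on_unique; eauto.
Qed.

(** Uniqueness pins down the value selected by [iota], so the total operator can be computed from
    any known derivative. *)
Lemma RDerive_on_correct a b f x l :
  a < b -> Icc a b x -> rd (Icc a b) f x l -> RDerive_on (Icc a b) f x = l.
Proof.
  intros ab Ix H; unfold RDerive_on, Derive_on.
  apply (iota_unique (V := R_CompleteNormedModule)); [|exact H].
  intros y Hy; exact (is_derive_on_unique a b f x y l ab Ix Hy H).
Qed.

Lemma CDerive_on_correct a b f x l :
  a < b -> Icc a b x -> cd (Icc a b) f x l -> CDerive_on (Icc a b) f x = l.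
Proof.
  intros ab Ix H; unfold CDerive_on, Derive_on.
  apply (iota_unique (V := C_R_CompleteNormedModule)); [|exact H].
  intros y Hy; exact (is_derive_on_C_unique a b f x y l ab Ix Hy H).
Qed.

Lemma is_derive_on_RtoC_mult (D : R -> Prop) (B : R -> R) (f : R -> C) x b l :
  D x -> rd D B x b -> cd D f x l ->
  cd D (fun y => RtoC (B y) * f y)%C x (RtoC b * f x + RtoC (B x) * l)%C.
Proof.
  intros Dx HB Hf; apply is_derive_on_C in Hf; destruct Hf as [H1 H2].
  apply is_derive_on_C; split.
  - apply (is_derive_on_ext D (fun y => B y * fst (f y)) _ _ _ Dx).
    { intros y _; simpl; ring. }
    replace (fst (RtoC b * f x + RtoC (B x) * l)%C) with (b * fst (f x) + B x * fst l)
      by (simpl; ring).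
    apply (is_derive_on_mult D B (fun y => fst (f y))); auto.
  - apply (is_derive_on_ext D (fun y => B y * snd (f y)) _ _ _ Dx).
    { intros y _; simpl; ring. }
    replace (snd (RtoC b * f x + RtoC (B x) * l)%C) with (b * snd (f x) + B x * snd l)
      by (simpl; ring).
    apply (is_derive_on_mult D B (fun y => snd (f y))); auto.
Qed.

Lemma is_derive_on_C_plus (D : R -> Prop) (f g : R -> C) x lf lg :
  D x -> cd D f x lf -> cd D g x lg -> cd D (fun y => f y + g y)%C x (lf + lg)%C.
Proof.
  intros Dx Hf Hg; apply is_derive_on_C in Hf; apply is_derive_on_C in Hg.
  destruct Hf, Hg.
  apply is_derive_on_C; split.
  - apply (is_derive_on_plus D (fun y => fst (f y)) (fun y => fst (g y))); auto.
  - apply (is_derive_on_plus D (fun y => snd (f y)) (fun y => snd (g y))); auto.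
Qed.

(* Re (conj w * z). *)
Definition dotC (w z : C) : R := fst w * fst z + snd w * snd z.

Lemma is_derive_on_dotC (D : R -> Prop) w (f : R -> C) x l :
  D x -> cd D f x l -> rd D (fun y => dotC w (f y)) x (dotC w l).
Proof.
  intros Dx H; apply is_derive_on_C in H; destruct H as [H1 H2].
  apply (is_derive_on_plus D (fun y => fst w * fst (f y)) (fun y => snd w * snd (f y)));
    apply is_derive_on_scal; auto.
Qed.

(** Cauchy-Schwarz in the plane, from Lagrange's identity [(a^2 + b^2)(c^2 + d^2) - (a c + b d)^2 =
    (a d - b c)^2]. *)
Lemma dotC_le w z : dotC w z <= Cmod w * Cmod z.
Proof.
  unfold dotC.
  destruct w as [a b], z as [c d]; simpl.
  assert (E : Cmod (a, b) * Cmod (c, d) = sqrt ((a^2+b^2)*(c^2+d^2))).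
  { unfold Cmod; simpl fst; simpl snd; rewrite sqrt_mult; [reflexivity|nra|nra]. }
  rewrite E.
  destruct (Rle_dec 0 (a * c + b * d)) as [P|P].
  - rewrite <- (sqrt_pow2 (a * c + b * d) P).
    apply sqrt_le_1_alt.
    generalize (pow2_ge_0 (a * d - b * c)); simpl; lra.
  - apply Rle_trans with 0; [lra|apply sqrt_pos].
Qed.

Lemma dotC_self w : dotC w w = Cmod w ^ 2.
Proof.
  unfold dotC, Cmod; rewrite pow2_sqrt by nra; ring.
Qed.

(** * Continuous functions on a compact interval *)

Definition clamp (a b x : R) : R := Rmax a (Rmin b x).

Lemma clamp_in a b x : a <= b -> Icc a b (clamp a b x).
Proof.
  intros ab; unfold Icc, clamp; split; [apply Rmax_l|].
  apply Rmax_lub; [exact ab|apply Rmin_l].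
Qed.

Lemma clamp_id a b x : Icc a b x -> clamp a b x = x.
Proof.
  intros [H1 H2]; unfold clamp; rewrite Rmin_right by exact H2; apply Rmax_right; exact H1.
Qed.

Lemma clamp_lip a b x y : a <= b -> Rabs (clamp a b y - clamp a b x) <= Rabs (y - x).
Proof.
  intros ab; unfold clamp, Rmax, Rmin.
  repeat destruct (Rle_dec _ _); unfold Rabs; repeat destruct (Rcase_abs _); lra.
Qed.

(** The clamp is a 1-Lipschitz retraction onto [[a, b]]; composing with it extends [f] continuously
    to the whole line, where the standard extreme value theorem applies. *)
Lemma continuous_on_clamp {V : UniformSpace} a b (f : R -> V) : a <= b ->
  continuous_on (Icc a b) f -> forall x, continuous (fun y => f (clamp a b y)) x.
Proof.
  intros ab H x.
  eapply filterlim_comp; [|apply H; apply clamp_in; exact ab].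
  intros P [e He].
  exists e; intros y Hy.
  apply He; [|apply clamp_in; exact ab].
  eapply Rle_lt_trans; [apply (clamp_lip a b x y ab)|exact Hy].
Qed.

Lemma continuous_on_max a b (f : R -> R) : a <= b ->
  continuous_on (Icc a b) f -> exists x, Icc a b x /\ forall y, Icc a b y -> f y <= f x.
Proof.
  intros ab H.
  destruct (continuity_ab_maj (fun y => f (clamp a b y)) a b ab) as [x [Hx Ix]].
  { intros c _; apply continuity_pt_filterlim; apply (continuous_on_clamp a b f ab H c). }
  exists x; split; [exact Ix|].
  intros y Iy; generalize (Hx y Iy); rewrite !clamp_id; auto.
Qed.

Lemma continuous_on_bounded a b (f : R -> R) : a <= b ->
  continuous_on (Icc a b) f -> exists M, 0 <= M /\ forall y, Icc a b y -> Rabs (f y) <= M.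
Proof.
  intros ab H.
  destruct (continuous_on_max a b (fun y => Rabs (f y)) ab) as [x [Ix Hx]].
  { intros y Iy; eapply filterlim_comp; [apply H; exact Iy|].
    apply (continuous_Rabs (f y)). }
  exists (Rabs (f x)); split; [apply Rabs_pos|exact Hx].
Qed.

(** * The master equation *)

(** Only points to the left of [x] are compared, so [x = b] is allowed. This serves for a maximum at
    the final time and for one at the right end of the spatial interval. *)
Lemma max_derive_ge0 a b (f : R -> R) x l :
  a < x -> Icc a b x -> rd (Icc a b) f x l ->
  (forall y, Icc a b y -> f y <= f x) -> 0 <= l.
Proof.
  intros ax Ix H Hm.
  destruct (Rle_dec 0 l) as [P|P]; [exact P|exfalso].
  destruct (proj1 (is_derive_on_eps _ f x l Ix) H (- l / 2)) as [d [d0 Hd]]; [lra|].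
  assert (h0 : 0 < Rmin (d / 2) (x - a)) by (apply Rmin_pos; lra).
  assert (h1 := Rmin_l (d / 2) (x - a)).
  assert (h2 := Rmin_r (d / 2) (x - a)).
  set (h := Rmin (d / 2) (x - a)) in *.
  assert (Iy : Icc a b (x - h)) by (destruct Ix; split; lra).
  assert (E : Rabs (x - h - x) = h) by (rewrite Rabs_left; lra).
  generalize (Hd (x - h) Iy); rewrite E; intros K.
  specialize (K ltac:(lra)).
  specialize (Hm _ Iy).
  apply Rabs_le_between in K.
  nra.
Qed.

Lemma max_derive_le0 a b (f : R -> R) x l :
  x < b -> Icc a b x -> rd (Icc a b) f x l ->
  (forall y, Icc a b y -> f y <= f x) -> l <= 0.
Proof.
  intros xb Ix H Hm.
  destruct (Rle_dec l 0) as [P|P]; [exact P|exfalso].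
  destruct (proj1 (is_derive_on_eps _ f x l Ix) H (l / 2)) as [d [d0 Hd]]; [lra|].
  assert (h0 : 0 < Rmin (d / 2) (b - x)) by (apply Rmin_pos; lra).
  assert (h1 := Rmin_l (d / 2) (b - x)).
  assert (h2 := Rmin_r (d / 2) (b - x)).
  set (h := Rmin (d / 2) (b - x)) in *.
  assert (Iy : Icc a b (x + h)) by (destruct Ix; split; lra).
  assert (E : Rabs (x + h - x) = h) by (rewrite Rabs_pos_eq; lra).
  generalize (Hd (x + h) Iy); rewrite E; intros K.
  specialize (K ltac:(lra)).
  specialize (Hm _ Iy).
  apply Rabs_le_between in K.
  nra.
Qed.

Lemma finite_family_max a b (p : nat -> R -> R) n : a <= b ->
  (forall k, (k <= n)%nat -> continuous_on (Icc a b) (p k)) ->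
  exists k t, (k <= n)%nat /\ Icc a b t /\
    forall j s, (j <= n)%nat -> Icc a b s -> p j s <= p k t.
Proof.
  intros ab; induction n as [|n IH]; intros H.
  - destruct (continuous_on_max a b (p O) ab (H O (le_n _))) as [t [It Ht]].
    exists O, t; repeat split; try apply It; auto.
    intros j s Hj; replace j with O by lia; auto.
  - destruct IH as [k [t [Hk [It Ht]]]]; [intros; apply H; lia|].
    destruct (continuous_on_max a b (p (S n)) ab (H (S n) (le_n _))) as [t' [It' Ht']].
    destruct (Rle_dec (p k t) (p (S n) t')) as [P|P].
    + exists (S n), t'; repeat split; try apply It'; auto.
      intros j s Hj Is; destruct (Nat.eq_dec j (S n)) as [->|ne]; [auto|].
      apply Rle_trans with (p k t); auto; apply Ht; auto; lia.
    + exists k, t; repeat split; try apply It; auto.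
      intros j s Hj Is; destruct (Nat.eq_dec j (S n)) as [->|ne].
      * apply Rle_trans with (p (S n) t'); auto; lra.
      * apply Ht; auto; lia.
Qed.

Section Master.
Variables (A Cf : R -> R) (N : nat) (L : R).
Hypothesis L0 : 0 <= L.
Hypothesis A0 : forall k, (k <= N)%nat -> 0 <= rate A N k.
Hypothesis C0 : forall k, (k <= N)%nat -> 0 <= rate Cf N k.
Hypothesis AL : forall k, (k < N)%nat -> rate A N k - rate A N (S k) <= L.
Hypothesis CL : forall k, (k < N)%nat -> rate Cf N (S k) - rate Cf N k <= L.

(** At a maximal component, the inflow from each neighbour is at most the matching outflow rate plus
    [L], times [q k]. The outflow cancels and [2 L] remains. At [k = 0] and [k = N] the absent
    inflow is covered by the sign of the rate. *)
Lemma master_rhs_le (q : nat -> R) k : (k <= N)%nat -> 0 <= q k ->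
  (forall j, (j <= N)%nat -> q j <= q k) ->
  master_rhs A Cf N q k <= 2 * L * q k.
Proof.
  intros Hk q0 Hq; unfold master_rhs.
  assert (E1 : match k with O => 0 | S j => rate A N j * q j end <= (rate A N k + L) * q k).
  { destruct k as [|j].
    - specialize (A0 O Hk); nra.
    - assert (a := A0 j ltac:(lia)); assert (b := AL j ltac:(lia)).
      assert (c := Hq j ltac:(lia)); nra. }
  assert (E2 : (if Nat.ltb k N then rate Cf N (S k) * q (S k) else 0) <= (rate Cf N k + L) * q k).
  { destruct (Nat.ltb_spec k N) as [P|P].
    - assert (a := C0 (S k) ltac:(lia)); assert (b := CL k ltac:(lia)).
      assert (c := Hq (S k) ltac:(lia)); nra.
    - specialize (C0 k Hk); nra. }
  lra.
Qed.

Lemma master_upper_bound (q : nat -> R -> R) U t : 0 <= U -> 0 <= t ->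
  (forall k, (k <= N)%nat -> q k 0 <= U) ->
  (forall k s, (k <= N)%nat -> 0 <= s ->
    rd (fun s => 0 <= s) (q k) s (master_rhs A Cf N (fun j => q j s) k)) ->
  forall k, (k <= N)%nat -> q k t <= U * exp ((2 * L + 1) * t).
Proof.
  intros U0 t0 H0 Hq.
  (* The extra [1] over [2 L] makes the derivative of [p] strictly negative wherever the maximum of
     the family is positive. *)
  pose (M := 2 * L + 1).
  pose (p := fun k s => exp (- M * s) * q k s).
  assert (Dp : forall k s, (k <= N)%nat -> Icc 0 t s ->
    rd (Icc 0 t) (p k) s (- M * exp (- M * s) * q k s
       + exp (- M * s) * master_rhs A Cf N (fun j => q j s) k)).
  { intros k s Hk Is.
    apply (is_derive_on_mult (Icc 0 t) (fun y => exp (- M * y)) (q k)); [exact Is| |].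
    - apply is_derive_is_derive_on; [exact Is|].
      auto_derive; [auto|ring].
    - apply (is_derive_on_subset (fun s => 0 <= s)); auto.
      + intros y Iy; apply Iy.
      + apply Hq; auto; apply Is. }
  destruct (finite_family_max 0 t p N t0) as [m [s [Hm [Is Hs]]]].
  { intros k Hk s Is; apply (is_derive_on_continuous _ _ _ _ (Dp k s Hk Is)). }
  assert (P : p m s <= U).
  { destruct (Rle_dec (p m s) U) as [P|P]; [exact P|exfalso].
    assert (Ex : 0 < exp (- M * s)) by apply exp_pos.
    assert (Q : 0 < q m s).
    { destruct (Rlt_dec 0 (q m s)) as [Y|Y]; [exact Y|unfold p in P; nra]. }
    assert (s0 : 0 < s).
    { destruct Is as [[Y|Y] _]; [exact Y|exfalso].
      apply P; unfold p; rewrite <- Y, Rmult_0_r, exp_0, Rmult_1_l; auto. }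
    assert (G := max_derive_ge0 0 t (p m) s _ s0 Is (Dp m s Hm Is) (fun y Iy => Hs m y Hm Iy)).
    assert (K : master_rhs A Cf N (fun j => q j s) m <= 2 * L * q m s).
    { apply (master_rhs_le (fun j => q j s)); [exact Hm|lra|].
      intros j Hj; apply Rmult_le_reg_l with (1 := Ex); apply (Hs j s Hj Is). }
    assert (K2 := Rmult_lt_0_compat _ _ Ex Q).
    assert (K3 := Rmult_le_compat_l _ _ _ (Rlt_le _ _ Ex) K).
    unfold M in *; nra. }
  intros k Hk.
  assert (Y : p k t <= U) by (apply Rle_trans with (p m s); [apply Hs; [auto|split; lra]|exact P]).
  unfold p in Y.
  replace (q k t) with (exp (M * t) * (exp (- M * t) * q k t)).
  - rewrite Rmult_comm; apply Rmult_le_compat_r; [apply Rlt_le, exp_pos|exact Y].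
  - rewrite <- Rmult_assoc, <- exp_plus.
    replace (M * t + - M * t) with 0 by ring; rewrite exp_0; ring.
Qed.

Lemma master_bound (u0 : R -> R) (q : nat -> R -> R) U t : 0 <= t ->
  (forall x, 0 <= x <= 1 -> Rabs (u0 x) <= U) ->
  (0 < N)%nat ->
  master_solution A Cf N u0 q ->
  forall k, (k <= N)%nat -> Rabs (q k t) <= U * exp ((2 * L + 1) * t).
Proof.
  intros t0 HU N0 [Hi Hq] k Hk.
  assert (U0 : 0 <= U).
  { apply Rle_trans with (Rabs (u0 0)); [apply Rabs_pos|apply HU; lra]. }
  assert (I : forall k, (k <= N)%nat -> Rabs (q k 0) <= U).
  { intros j Hj; rewrite Hi by exact Hj; apply HU.
    assert (0 < INR N) by (apply lt_0_INR; exact N0).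
    assert (0 <= INR j) by apply pos_INR.
    assert (INR j <= INR N) by (apply le_INR; exact Hj).
    split; [apply Rdiv_le_0_compat; auto|].
    apply Rle_div_l; lra. }
  apply Rabs_le_between; split.
  (* The equation is linear, so the lower bound for [q] is the upper bound for [- q]. *)
  - assert (H : - q k t <= U * exp ((2 * L + 1) * t)).
    { apply (master_upper_bound (fun k s => - q k s)); auto.
      - intros j Hj; specialize (I j Hj); apply Rabs_le_between in I; lra.
      - intros j s Hj Hs.
        apply (is_derive_on_ext _ (fun y => (-1) * q j y));
          [exact Hs|intros y _; simpl; ring|].
        replace (master_rhs A Cf N (fun i => - q i s) j)
          with ((-1) * master_rhs A Cf N (fun i => q i s) j).
        + apply is_derive_on_scal; auto.
        + unfold master_rhs; destruct j; destruct (Nat.ltb _ _); ring. }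
    lra.
  - assert (H : q k t <= U * exp ((2 * L + 1) * t)).
    { apply (master_upper_bound q); auto.
      intros j Hj; specialize (I j Hj); apply Rabs_le_between in I; lra. }
    lra.
Qed.
End Master.

(** * Uniform boundedness on C(I) *)

Lemma norm_C_R (z : C) : norm (z : C_R_NormedModule) = Cmod z.
Proof.
  change (sqrt (Rabs (fst z) ^ 2 + Rabs (snd z) ^ 2) = sqrt (fst z ^ 2 + snd z ^ 2)).
  rewrite <- !Rsqr_pow2, <- !Rsqr_abs; reflexivity.
Qed.

Lemma inCI_eps (I : R -> Prop) (f : cfun) :
  inCI I f <-> forall x eps, I x -> 0 < eps -> exists d, 0 < d /\
    forall y, I y -> Rabs (y - x) < d -> Cmod (f y - f x)%C < eps.
Proof.
  split.
  - intros H x eps Ix e0.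
    destruct (proj1 (filterlim_locally_ball_norm (U := C_R_NormedModule) _ _) (H x Ix)
      (mkposreal eps e0)) as [d Hd].
    exists d; split; [apply cond_pos|].
    intros y Iy Hy; generalize (Hd y Hy Iy); unfold ball_norm; rewrite norm_C_R; auto.
  - intros H x Ix.
    apply (filterlim_locally_ball_norm (U := C_R_NormedModule)).
    intros eps; destruct (H x eps Ix (cond_pos eps)) as [d [d0 Hd]].
    exists (mkposreal d d0); intros y Hy Iy; unfold ball_norm; rewrite norm_C_R.
    apply (Hd y Iy Hy).
Qed.

Lemma inCI_lin I (a b : C) f g : inCI I f -> inCI I g ->
  inCI I (fun x => a * f x + b * g x)%C.
Proof.
  intros Hf Hg; apply inCI_eps; intros x eps Ix e0.
  assert (A0 := Cmod_ge_0 a); assert (B0 := Cmod_ge_0 b).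
  pose (e := eps / (Cmod a + Cmod b + 1)).
  assert (e1 : 0 < e) by (apply Rdiv_lt_0_compat; lra).
  assert (e2 : eps = e * (Cmod a + Cmod b + 1)) by (unfold e; field; lra).
  destruct (proj1 (inCI_eps I f) Hf x e Ix e1) as [d [d0 Hd]].
  destruct (proj1 (inCI_eps I g) Hg x e Ix e1) as [d' [d0' Hd']].
  exists (Rmin d d'); split; [apply Rmin_pos; auto|].
  intros y Iy Hy.
  assert (Y1 := Hd y Iy (Rlt_le_trans _ _ _ Hy (Rmin_l _ _))).
  assert (Y2 := Hd' y Iy (Rlt_le_trans _ _ _ Hy (Rmin_r _ _))).
  replace (a * f y + b * g y - (a * f x + b * g x))%C
    with (a * (f y - f x) + b * (g y - g x))%C by ring.
  eapply Rle_lt_trans; [apply Cmod_triangle|]; rewrite !Cmod_mult.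
  assert (Z1 := Cmod_ge_0 (f y - f x)%C); assert (Z2 := Cmod_ge_0 (g y - g x)%C).
  nra.
Qed.

Lemma inCI_zero I : inCI I (fun _ => RtoC 0).
Proof.
  apply inCI_eps; intros x eps _ e0; exists 1; split; [lra|].
  intros y _ _; replace (RtoC 0 - RtoC 0)%C with (RtoC 0) by ring; rewrite Cmod_0; exact e0.
Qed.

Lemma RtoC_m1 : RtoC (-1) = (- RtoC 1)%C.
Proof. unfold RtoC, Copp; simpl; f_equal; ring. Qed.

Lemma Cmod_sub_le (x y : C) : Cmod x <= Cmod y + Cmod (x - y)%C.
Proof.
  replace x with (y + (x - y))%C at 1 by ring; apply Cmod_triangle.
Qed.

Lemma Cmod_sub_sym (x y : C) : Cmod (x - y)%C = Cmod (y - x)%C.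
Proof. rewrite <- (Cmod_opp (x - y)); f_equal; ring. Qed.

Lemma inCI_Cmod I f : inCI I f -> continuous_on I (fun x => Cmod (f x)).
Proof.
  intros Hf x Ix.
  apply (filterlim_locally (F := within I (locally x))); intros eps.
  destruct (proj1 (inCI_eps I f) Hf x eps Ix (cond_pos eps)) as [d [d0 Hd]].
  exists (mkposreal d d0); intros y Hy Iy.
  specialize (Hd y Iy Hy).
  change (Rabs (Cmod (f y) - Cmod (f x)) < eps).
  assert (X := Cmod_sub_le (f y) (f x)); assert (Y := Cmod_sub_le (f x) (f y)).
  rewrite Cmod_sub_sym in Y.
  apply Rabs_lt_between; lra.
Qed.

Lemma leCI_weaken I f B B' : leCI I f B -> B <= B' -> leCI I f B'.
Proof. intros H HB x Ix; apply Rle_trans with B; auto. Qed.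

Definition op_linear (I : R -> Prop) (S : cfun -> cfun) : Prop :=
  forall (a b : C) f g, inCI I f -> inCI I g ->
    eqCI I (S (fun x => a * f x + b * g x)%C) (fun x => a * S f x + b * S g x)%C.

(** An operator norm bound stated without forming a sup norm: [B] ranges over all bounds of the
    argument on [I], and values off [I] do not enter. *)
Definition op_bound (I : R -> Prop) (S : cfun -> cfun) (M : R) : Prop :=
  forall f B, inCI I f -> leCI I f B -> leCI I (S f) (M * B).

Lemma op_bound_weaken I x0 S M M' : I x0 -> M <= M' -> op_bound I S M -> op_bound I S M'.
Proof.
  intros I0 HM H f B Hf HB.
  apply leCI_weaken with (M * B); [auto|].
  assert (0 <= B) by (apply Rle_trans with (Cmod (f x0)); [apply Cmod_ge_0|auto]).
  nra.
Qed.

(** The number [m] is the operator norm, taken as a supremum over the unit ball. It need not be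
    attained, hence the approximate maximisers. *)
Lemma op_norm I x0 S M : I x0 -> op_linear I S -> op_bound I S M ->
  exists m, op_bound I S m /\ forall r, r < m ->
    exists f x, inCI I f /\ leCI I f 1 /\ I x /\ r < Cmod (S f x).
Proof.
  intros I0 HL HM.
  pose (E := fun r => exists f x, inCI I f /\ leCI I f 1 /\ I x /\ r = Cmod (S f x)).
  destruct (completeness E) as [m [Hub Hlub]].
  - exists (M * 1); intros r [f [x [Hf [H1 [Ix ->]]]]]; apply (HM f 1 Hf H1 x Ix).
  - exists (Cmod (S (fun _ => RtoC 0) x0)), (fun _ => RtoC 0), x0.
    repeat split; auto using inCI_zero.
    intros x _; rewrite Cmod_0; lra.
  - assert (m0 : 0 <= m).
    { eapply Rle_trans; [apply Cmod_ge_0|apply Hub; exists (fun _ => RtoC 0), x0].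
      repeat split; auto using inCI_zero.
      intros x _; rewrite Cmod_0; lra. }
    exists m; split.
    + intros f B Hf HB x Ix.
      assert (B0 : 0 <= B) by (apply Rle_trans with (Cmod (f x0)); [apply Cmod_ge_0|auto]).
      apply le_epsilon; intros eps e0.
      (* [B] may vanish, so [f] is normalised by a slightly larger positive [B']; the excess costs
         at most [m eps / (m + 1) <= eps]. *)
      pose (B' := B + eps / (m + 1)).
      assert (0 < eps / (m + 1)) by (apply Rdiv_lt_0_compat; lra).
      assert (B0' : 0 < B') by (unfold B'; lra).
      (* The summand with coefficient [RtoC 0] is padding that gives the two-term shape handled by
         [op_linear]. *)
      assert (K : Cmod (S (fun y => RtoC (/ B') * f y + RtoC 0 * f y)%C x) <= m).
      { apply Hub; eexists _, x; repeat split; auto.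
        - apply inCI_lin; exact Hf.
        - intros y Iy.
          replace (RtoC (/ B') * f y + RtoC 0 * f y)%C with (RtoC (/ B') * f y)%C by ring.
          rewrite Cmod_mult, Cmod_R, Rabs_pos_eq by (apply Rlt_le, Rinv_0_lt_compat; auto).
          apply Rmult_le_reg_l with B'; [auto|].
          rewrite <- Rmult_assoc, Rinv_r by lra.
          specialize (HB y Iy); unfold B'; lra. }
      rewrite (HL _ _ f f Hf Hf x Ix) in K.
      replace (RtoC (/ B') * S f x + RtoC 0 * S f x)%C with (RtoC (/ B') * S f x)%C in K by ring.
      rewrite Cmod_mult, Cmod_R, Rabs_pos_eq in K by (apply Rlt_le, Rinv_0_lt_compat; auto).
      apply Rle_trans with (m * B').
      * apply Rmult_le_compat_r with (r := B') in K; [|lra].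
        replace (/ B' * Cmod (S f x) * B') with (Cmod (S f x)) in K by (field; lra).
        exact K.
      * unfold B'.
        assert (m * (eps / (m + 1)) <= eps).
        { replace eps with ((m + 1) * (eps / (m + 1))) at 2 by (field; lra).
          nra. }
        lra.
    + intros r Hr; apply NNPP; intros HN.
      apply (Rlt_not_le _ _ Hr); apply Hlub.
      intros r' [f [x [Hf [H1 [Ix ->]]]]].
      destruct (Rle_dec (Cmod (S f x)) r) as [P|P]; [exact P|exfalso].
      apply HN; exists f, x; repeat split; auto; lra.
Qed.

(* One of [S (z + r xi)], [S (z - r xi)] is at least as large as [r S xi],
   half their difference. *)
Lemma hump_step I S m r z : op_linear I S -> 0 < m -> 0 < r -> inCI I z ->
  (forall r, r < m -> exists f x, inCI I f /\ leCI I f 1 /\ I x /\ r < Cmod (S f x)) ->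
  exists z', inCI I z' /\ (forall x, I x -> Cmod (z' x - z x)%C <= r) /\
    exists x, I x /\ 2 / 3 * m * r <= Cmod (S z' x).
Proof.
  intros HL m0 r0 Hz Hm.
  destruct (Hm (2 / 3 * m)) as [f [x [Hf [H1 [Ix Hx]]]]]; [lra|].
  pose (w := fun e y => (RtoC 1 * z y + RtoC e * f y)%C).
  assert (W : forall e, Rabs e = r -> inCI I (w e) /\
     forall y, I y -> Cmod (w e y - z y)%C <= r).
  { intros e He; split; [apply inCI_lin; auto|].
    intros y Iy; unfold w.
    replace (RtoC 1 * z y + RtoC e * f y - z y)%C with (RtoC e * f y)%C by ring.
    rewrite Cmod_mult, Cmod_R, He; specialize (H1 y Iy); nra. }
  assert (D : 2 * (2 / 3 * m * r) <= Cmod (S (w r) x) + Cmod (S (w (- r)) x)).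
  { unfold w; rewrite !(HL _ _ z f Hz Hf x Ix).
    apply Rle_trans with (Cmod (RtoC (2 * r) * S f x)%C).
    - rewrite Cmod_mult, Cmod_R, Rabs_pos_eq by lra; nra.
    - replace (RtoC (2 * r) * S f x)%C with
        ((RtoC 1 * S z x + RtoC r * S f x) + - (RtoC 1 * S z x + RtoC (- r) * S f x))%C
        by (rewrite RtoC_mult, RtoC_opp; ring).
      eapply Rle_trans; [apply Cmod_triangle|]; rewrite Cmod_opp; lra. }
  destruct (Rle_dec (2 / 3 * m * r) (Cmod (S (w r) x))) as [P|P].
  - destruct (W r (Rabs_pos_eq _ (Rlt_le _ _ r0))) as [W1 W2].
    exists (w r); repeat split; auto; exists x; auto.
  - destruct (W (- r)) as [W1 W2]; [rewrite Rabs_Ropp; apply Rabs_pos_eq; lra|].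
    exists (w (- r)); repeat split; auto; exists x; split; auto; lra.
Qed.

Lemma Cmod_le_components (z : C) : Cmod z <= Rabs (fst z) + Rabs (snd z).
Proof.
  replace z with (RtoC (fst z) + Ci * RtoC (snd z))%C at 1
    by (destruct z; unfold Cplus, Cmult, RtoC, Ci; simpl; f_equal; ring).
  eapply Rle_trans; [apply Cmod_triangle|].
  rewrite Cmod_mult, !Cmod_R.
  replace (Cmod Ci) with 1; [lra|].
  unfold Cmod; simpl; replace (0 * (0 * 1) + 1 * (1 * 1)) with 1 by ring; rewrite sqrt_1; auto.
Qed.

Lemma components_le_Cmod (z : C) : Rabs (fst z) <= Cmod z /\ Rabs (snd z) <= Cmod z.
Proof.
  assert (H := Rmax_Cmod z).
  split; eapply Rle_trans; [apply Rmax_l|exact H|apply Rmax_r|exact H].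
Qed.

(** Completeness of [C(I)] for geometric steps: the powers of [1/3] beyond the [n]-th sum to half of
    the [n]-th. The limit is taken in each real component, and uniform convergence preserves
    continuity. *)
Lemma inCI_fast_limit I (y : nat -> cfun) :
  (forall n, inCI I (y n)) ->
  (forall n x, I x -> Cmod (y (S n) x - y n x)%C <= (/ 3) ^ S n) ->
  exists f, inCI I f /\ forall n x, I x -> Cmod (f x - y n x)%C <= / 2 * (/ 3) ^ n.
Proof.
  intros Hy Hs.
  assert (P3 : forall n, 0 < (/ 3) ^ n) by (intros n; apply pow_lt; lra).
  assert (T : forall n k x, I x -> Cmod (y (n + k)%nat x - y n x)%C <= / 2 * ((/ 3) ^ n - (/ 3) ^ (n + k))).
  { intros n k x Ix; induction k as [|k IH].
    - rewrite Nat.add_0_r; replace (y n x - y n x)%C with (RtoC 0) by ring; rewrite Cmod_0; lra.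
    - rewrite Nat.add_succ_r.
      replace (y (S (n + k)) x - y n x)%C
        with ((y (S (n + k)) x - y (n + k)%nat x) + (y (n + k)%nat x - y n x))%C by ring.
      eapply Rle_trans; [apply Cmod_triangle|].
      specialize (Hs (n + k)%nat x Ix); simpl in *; lra. }
  assert (Tl : forall n p x, I x -> (n <= p)%nat -> Cmod (y p x - y n x)%C <= / 2 * (/ 3) ^ n).
  { intros n p x Ix Hnp; replace p with (n + (p - n))%nat by lia.
    specialize (T n (p - n)%nat x Ix); specialize (P3 (n + (p - n))%nat); lra. }
  assert (Small : forall eps, 0 < eps -> exists n, (/ 3) ^ n < eps).
  { intros eps e0; destruct (pow_lt_1_zero (/ 3)) with eps as [n Hn]; auto.
    - rewrite Rabs_pos_eq; lra.
    - exists n; specialize (Hn n (le_n _)); rewrite Rabs_pos_eq in Hn; auto.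
      apply Rlt_le, P3. }
  (* [c] stands for [fst] or [snd]; only its 1-Lipschitz property matters for the Cauchy
     criterion. *)
  assert (L : forall (c : C -> R), (forall u v, Rabs (c u - c v) <= Cmod (u - v)%C) ->
    forall x, I x -> ex_finite_lim_seq (fun n => c (y n x))).
  { intros c Hc x Ix; apply ex_lim_seq_cauchy_corr; intros eps.
    destruct (Small eps (cond_pos eps)) as [n0 Hn0].
    exists n0; intros n p Hn Hp.
    replace (c (y n x) - c (y p x)) with ((c (y n x) - c (y n0 x)) - (c (y p x) - c (y n0 x))) by ring.
    eapply Rle_lt_trans; [apply Rabs_triang|]; rewrite Rabs_Ropp.
    assert (X := Hc (y n x) (y n0 x)); assert (Y := Hc (y p x) (y n0 x)).
    assert (X' := Tl n0 n x Ix Hn); assert (Y' := Tl n0 p x Ix Hp).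
    lra. }
  assert (c1 : forall u v : C, Rabs (fst u - fst v) <= Cmod (u - v)%C).
  { intros u v; apply (proj1 (components_le_Cmod (u - v)%C)). }
  assert (c2 : forall u v : C, Rabs (snd u - snd v) <= Cmod (u - v)%C).
  { intros u v; apply (proj2 (components_le_Cmod (u - v)%C)). }
  pose (f := fun x => (real (Lim_seq (fun n => fst (y n x))), real (Lim_seq (fun n => snd (y n x)))) : C).
  assert (F : forall n x, I x -> Cmod (f x - y n x)%C <= / 2 * (/ 3) ^ n).
  { intros n x Ix; apply le_epsilon; intros eps e0.
    assert (e1 : 0 < eps / 2) by lra.
    destruct (proj2 (is_lim_seq_spec _ _) (Lim_seq_correct' _ (L fst c1 x Ix)) (mkposreal _ e1)) as [n1 H1].
    destruct (proj2 (is_lim_seq_spec _ _) (Lim_seq_correct' _ (L snd c2 x Ix)) (mkposreal _ e1)) as [n2 H2].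
    simpl in H1, H2.
    pose (p := (n + n1 + n2)%nat).
    specialize (H1 p ltac:(unfold p; lia)); specialize (H2 p ltac:(unfold p; lia)).
    assert (X := Tl n p x Ix ltac:(unfold p; lia)).
    replace (f x - y n x)%C with ((f x - y p x) + (y p x - y n x))%C by ring.
    eapply Rle_trans; [apply Cmod_triangle|].
    assert (Y := Cmod_le_components (y p x - f x)%C).
    rewrite Cmod_sub_sym in Y.
    change (fst (y p x - f x)%C) with (fst (y p x) - Lim_seq (fun n => fst (y n x))) in Y.
    change (snd (y p x - f x)%C) with (snd (y p x) - Lim_seq (fun n => snd (y n x))) in Y.
    lra. }
  exists f; split; [|exact F].
  apply inCI_eps; intros x eps Ix e0.
  destruct (Small (eps / 2)) as [n Hn]; [lra|].
  destruct (proj1 (inCI_eps I (y n)) (Hy n) x (eps / 2) Ix) as [d [d0 Hd]]; [lra|].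
  exists d; split; [exact d0|]; intros z Iz Hz.
  replace (f z - f x)%C with ((f z - y n z) + ((y n z - y n x) + - (f x - y n x)))%C by ring.
  eapply Rle_lt_trans; [apply Cmod_triangle|].
  eapply Rle_lt_trans; [apply Rplus_le_compat_l, Cmod_triangle|].
  rewrite Cmod_opp.
  assert (X := F n z Iz); assert (Y := F n x Ix); specialize (Hd z Iz Hz).
  lra.
Qed.

(* Sokal's elementary proof of the uniform boundedness theorem. *)
Lemma gliding_hump I x0 (S : nat -> cfun -> cfun) :
  I x0 -> (forall n, op_linear I (S n)) -> (forall n, exists M, op_bound I (S n) M) ->
  (forall n, ~ op_bound I (S n) (4 ^ n)) ->
  exists f, inCI I f /\ forall n, exists x, I x /\ (4 / 3) ^ n / 6 <= Cmod (S n f x).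
Proof.
  intros I0 HL HB HN.
  (* [m n] is the norm of [S n], which exceeds [4 ^ n] because otherwise [4 ^ n] would be a
     bound. *)
  assert (E : forall n, exists m, 4 ^ n < m /\ op_bound I (S n) m /\ forall r, r < m ->
    exists f x, inCI I f /\ leCI I f 1 /\ I x /\ r < Cmod (S n f x)).
  { intros n; destruct (HB n) as [M HM].
    destruct (op_norm I x0 (S n) M I0 (HL n) HM) as [m [Hm1 Hm2]].
    exists m; repeat split; auto.
    destruct (Rlt_dec (4 ^ n) m) as [P|P]; [exact P|exfalso].
    apply (HN n); apply (op_bound_weaken I x0 _ m); auto; lra. }
  destruct (functional_choice _ E) as [m Hm]; clear E.
  assert (P4 : forall n, 0 < 4 ^ n) by (intros n; apply pow_lt; lra).
  assert (P3 : forall n, 0 < (/ 3) ^ n) by (intros n; apply pow_lt; lra).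
  (* Membership in [C(I)] is a premise inside the existential, so that choice yields a single step
     function defined on all pairs of a stage and a current function. *)
  assert (E : forall p : nat * cfun, exists z', inCI I (snd p) ->
     inCI I z' /\ (forall x, I x -> Cmod (z' x - snd p x)%C <= (/ 3) ^ fst p) /\
    exists x, I x /\ 2 / 3 * m (fst p) * (/ 3) ^ fst p <= Cmod (S (fst p) z' x)).
  { intros [n z]; simpl.
    destruct (classic (inCI I z)) as [Hz|Hz]; [|exists z; intros; contradiction].
    destruct (Hm n) as [M1 [M2 M3]]; specialize (P4 n).
    destruct (hump_step I (S n) (m n) ((/ 3) ^ n) z (HL n) ltac:(lra) (P3 n) Hz M3) as [z' Hz'].
    exists z'; auto. }
  destruct (functional_choice _ E) as [F HF]; clear E.
  pose (y := fix y n := match n with O => F (O, fun _ => RtoC 0) | Datatypes.S k => F (n, y k) end).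
  assert (Y0 : forall n, inCI I (y n)).
  { induction n as [|n IH]; [apply (HF (O, fun _ => RtoC 0) (inCI_zero I))|].
    apply (HF (Datatypes.S n, y n) IH). }
  destruct (inCI_fast_limit I y Y0) as [f [Hf1 Hf2]].
  { intros n; apply (HF (Datatypes.S n, y n) (Y0 n)). }
  exists f; split; [exact Hf1|]; intros n.
  assert (K : exists x, I x /\ 2 / 3 * m n * (/ 3) ^ n <= Cmod (S n (y n) x)).
  { destruct n as [|n]; [apply (HF (O, fun _ => RtoC 0) (inCI_zero I))|].
    apply (HF (Datatypes.S n, y n) (Y0 n)). }
  destruct K as [x [Ix Hx]]; exists x; split; [exact Ix|].
  destruct (Hm n) as [M1 [M2 _]].
  (* Passing from [y n] to the limit loses at most [m n / 2] times [3^-n], out of [2/3] of the same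
     quantity. The remaining sixth is at least [(4/3)^n / 6], since [m n > 4^n]. *)
  assert (Q : leCI I (S n (fun x => RtoC 1 * f x + RtoC (-1) * y n x)%C) (m n * (/ 2 * (/ 3) ^ n))).
  { apply M2; [apply inCI_lin; auto|].
    intros z Iz; replace (RtoC 1 * f z + RtoC (-1) * y n z)%C with (f z - y n z)%C; auto.
    rewrite RtoC_m1; ring. }
  specialize (Q x Ix); rewrite (HL n _ _ _ _ Hf1 (Y0 n) x Ix) in Q.
  replace (RtoC 1 * S n f x + RtoC (-1) * S n (y n) x)%C with (S n f x - S n (y n) x)%C in Q
    by (rewrite RtoC_m1; ring).
  rewrite Cmod_sub_sym in Q.
  assert (X := Cmod_sub_le (S n (y n) x) (S n f x)).
  assert (Z : (4 / 3) ^ n <= m n * (/ 3) ^ n).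
  { unfold Rdiv; rewrite Rpow_mult_distr; specialize (P3 n); nra. }
  lra.
Qed.

(** * Growth of a semigroup with quasi-dissipative generator *)

Lemma sup_lim0_ex I F g eps : sup_lim0 I F g -> 0 < eps ->
  exists d, 0 < d /\ forall t, 0 < t < d -> leCI I (fun x => F t x - g x)%C eps.
Proof.
  intros H e0; destruct (H eps e0) as [d Hd].
  exists d; split; [apply cond_pos|].
  intros t [t0 td]; apply Hd; [|exact t0].
  change (Rabs (t - 0) < d); rewrite Rminus_0_r, Rabs_pos_eq; lra.
Qed.

Lemma sg_op_linear I T t : C0_semigroup I T -> 0 <= t -> op_linear I (T t).
Proof. intros H Ht a b f g Hf Hg; apply (sg_linear I T H); auto. Qed.

(** Otherwise there are times [t n <= 1 / (n + 1)] at which [T (t n)] violates the bound [4 ^ n].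
    The gliding hump then produces one [f] whose orbit is unbounded along these times, against
    strong continuity at [0]. *)
Lemma semigroup_bounded_near_0 a b T : a <= b -> C0_semigroup (Icc a b) T ->
  exists d M, 0 < d /\ 1 <= M /\ forall t, 0 <= t <= d -> op_bound (Icc a b) (T t) M.
Proof.
  intros ab H; apply NNPP; intros HN.
  set (I := Icc a b) in *.
  assert (I0 : I a) by (split; lra).
  assert (E : forall n, exists t, 0 <= t <= / (INR n + 1) /\ ~ op_bound I (T t) (4 ^ n)).
  { intros n; apply NNPP; intros K; apply HN.
    exists (/ (INR n + 1)), (4 ^ n).
    assert (Q := pos_INR n).
    repeat split; [apply Rinv_0_lt_compat; lra|apply pow_R1_Rle; lra|].
    intros t Ht; apply NNPP; intros K'; apply K; exists t; auto. }
  destruct (functional_choice _ E) as [t Ht].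
  destruct (gliding_hump I a (fun n => T (t n)) I0) as [f [Hf Hx]].
  - intros n; apply sg_op_linear; [exact H|apply Ht].
  - intros n; destruct (sg_bounded I T H (t n)) as [M HM]; [apply Ht|].
    exists M; exact HM.
  - intros n; apply Ht.
  - destruct (continuous_on_bounded a b _ ab (inCI_Cmod I f Hf)) as [F [F0 HF]].
    destruct (sup_lim0_ex I _ _ 1 (sg_cont I T H f Hf) Rlt_0_1) as [d [d0 Hd]].
    (* The first summand ensures [t n < d]. The second, with Bernoulli's inequality
       [(4/3)^n >= 1 + n/3], pushes [(4/3)^n / 6] above [F + 1]. *)
    destruct (INR_unbounded (/ d + 18 * (F + 1))) as [n Hn].
    assert (D := Rinv_0_lt_compat _ d0).
    destruct (Ht n) as [[Ht0 Ht1] _].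
    assert (td : t n < d).
    { apply Rle_lt_trans with (1 := Ht1).
      rewrite <- (Rinv_inv d); apply Rinv_lt_contravar; [apply Rmult_lt_0_compat; lra|lra]. }
    destruct (Hx n) as [x [Ix Hxn]].
    assert (B : Cmod (T (t n) f x) <= F + 1).
    { specialize (HF x Ix); rewrite Rabs_pos_eq in HF by apply Cmod_ge_0.
      destruct (Rle_lt_or_eq_dec _ _ Ht0) as [P|P].
      - specialize (Hd (t n) (conj P td) x Ix); simpl in Hd.
        assert (X := Cmod_sub_le (T (t n) f x) (f x)); lra.
      - rewrite <- P, (sg_zero I T H f Hf x Ix); lra. }
    assert (P := poly n (/ 3) ltac:(lra)).
    replace (1 + / 3) with (4 / 3) in P by field.
    lra.
Qed.

(** The semigroup law propagates the bound [M] on [[0, d]] to [M ^ n] on [[0, n d]]; [M >= 1] keeps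
    these powers increasing. *)
Lemma semigroup_locally_bounded a b T tau : a <= b -> C0_semigroup (Icc a b) T ->
  exists M, 0 < M /\ forall t, 0 <= t <= tau -> op_bound (Icc a b) (T t) M.
Proof.
  intros ab H.
  set (I := Icc a b) in *.
  assert (I0 : I a) by (split; lra).
  destruct (semigroup_bounded_near_0 a b T ab H) as [d [M [d0 [M1 HM]]]]; fold I in HM.
  assert (K : forall n t, 0 <= t <= INR n * d -> op_bound I (T t) (M ^ n)).
  { induction n as [|n IH]; intros t Ht.
    - simpl in Ht; replace t with 0 by lra.
      intros f B Hf HB x Ix; rewrite (sg_zero I T H f Hf x Ix); specialize (HB x Ix); simpl; lra.
    - rewrite S_INR in Ht.
      assert (0 < M ^ n) by (apply pow_lt; lra).
      assert (1 <= M ^ n) by (apply pow_R1_Rle; lra).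
      destruct (Rle_dec t d) as [P|P].
      + apply (op_bound_weaken I a _ M); auto; [simpl; nra|apply HM; lra].
      + intros f B Hf HB x Ix.
        replace t with (d + (t - d)) by ring.
        rewrite (sg_add I T H d (t - d) f) by (auto; lra).
        simpl; rewrite Rmult_assoc.
        apply (HM d); [lra|apply (sg_closed I T H); auto; lra| |exact Ix].
        apply (IH (t - d)); auto; lra. }
  destruct (INR_unbounded (tau / d)) as [n Hn].
  exists (M ^ n); split; [apply pow_lt; lra|].
  intros t Ht; apply K; split; [lra|].
  apply Rle_trans with tau; [lra|].
  replace tau with (tau / d * d) by (field; lra).
  apply Rmult_le_compat_r; lra.
Qed.

Lemma op_linear_sub I (S : cfun -> cfun) f g : op_linear I S -> inCI I f -> inCI I g ->
  eqCI I (S (fun x => RtoC 1 * f x + RtoC (-1) * g x)%C) (fun x => S f x - S g x)%C.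
Proof.
  intros HL Hf Hg x Ix; rewrite (HL _ _ f g Hf Hg x Ix), RtoC_m1; ring.
Qed.

(** [T t] commutes with [T s], so the difference quotient of [T t f] is [T t] applied to that of
    [f], and boundedness of [T t] carries the limit over. *)
Lemma generator_semigroup I T f g t : C0_semigroup I T -> 0 <= t ->
  generator I T f g -> generator I T (T t f) (T t g).
Proof.
  intros H Ht [Hf [Hg Hl]].
  assert (Hf' := sg_closed I T H t f Ht Hf); assert (Hg' := sg_closed I T H t g Ht Hg).
  split; [exact Hf'|split; [exact Hg'|]].
  destruct (sg_bounded I T H t Ht) as [M HM].
  intros eps e0.
  assert (A0 := Rabs_pos M).
  (* The bound [M] carries no sign information, hence the positive denominator [Rabs M + 1]. *)
  destruct (sup_lim0_ex I _ _ (eps / (Rabs M + 1)) Hl) as [d [d0 Hd]].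
  { apply Rdiv_lt_0_compat; lra. }
  exists (mkposreal d d0); intros s Hs s0 x Ix.
  change (Rabs (s - 0) < d) in Hs; rewrite Rminus_0_r, Rabs_pos_eq in Hs by lra.
  assert (Hs' : 0 <= s) by lra.
  assert (HTs := sg_closed I T H s f Hs' Hf).
  assert (L1 := inCI_lin I (RtoC (/ s)) (RtoC (- / s)) _ _ HTs Hf).
  assert (L2 := inCI_lin I (RtoC 1) (RtoC (-1)) _ _ L1 Hg).
  assert (B : leCI I (fun x => RtoC 1 * (RtoC (/ s) * T s f x + RtoC (- / s) * f x) + RtoC (-1) * g x)%C
     (eps / (Rabs M + 1))).
  { intros y Iy; replace (_ + _)%C with ((T s f y - f y) / RtoC s - g y)%C.
    - apply (Hd s ltac:(lra) y Iy).
    - rewrite RtoC_m1, RtoC_opp; unfold Cdiv; rewrite <- RtoC_inv by lra; ring. }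
  assert (Q := HM _ _ L2 B x Ix); cbv beta in Q.
  rewrite (op_linear_sub I (T t) _ _ (sg_op_linear I T t H Ht) L1 Hg x Ix) in Q.
  rewrite (sg_linear I T H t _ _ _ _ Ht HTs Hf x Ix) in Q.
  assert (C1 : T t (T s f) x = T s (T t f) x).
  { rewrite <- (sg_add I T H t s f Ht Hs' Hf x Ix), Rplus_comm.
    apply (sg_add I T H s t f Hs' Ht Hf x Ix). }
  rewrite C1 in Q.
  replace ((T s (T t f) x - T t f x) / RtoC s - T t g x)%C
    with (RtoC (/ s) * T s (T t f) x + RtoC (- / s) * T t f x - T t g x)%C.
  - eapply Rle_trans; [exact Q|].
    assert (0 < eps / (Rabs M + 1)) by (apply Rdiv_lt_0_compat; lra).
    replace eps with ((Rabs M + 1) * (eps / (Rabs M + 1))) at 2 by (field; lra).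
    assert (X := Rle_abs M); nra.
  - rewrite RtoC_opp; unfold Cdiv; rewrite <- RtoC_inv by lra; ring.
Qed.

(** The defect is [T t] applied to [T s f - s T s g - f], which equals
    [s ((T s f - f) / s - g) - s (T s g - g)]. Both brackets are small for small [s], independently
    of [t]. *)
Lemma backward_euler_error I T f g M tau eps : C0_semigroup I T -> generator I T f g ->
  0 < eps -> (forall t, 0 <= t <= tau -> op_bound I (T t) M) ->
  exists d, 0 < d /\ forall s t, 0 < s < d -> 0 <= t <= tau ->
    leCI I (fun x => T (t + s)%R f x - RtoC s * T (t + s)%R g x - T t f x)%C (M * (2 * s * eps)).
Proof.
  intros H [Hf [Hg Hl]] e0 HM.
  destruct (sup_lim0_ex I _ _ eps Hl e0) as [d [d0 Hd]].
  destruct (sup_lim0_ex I _ _ eps (sg_cont I T H g Hg) e0) as [d' [d0' Hd']].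
  exists (Rmin d d'); split; [apply Rmin_pos; auto|].
  intros s t [s0 sd] Ht x Ix.
  assert (sd1 := Rlt_le_trans _ _ _ sd (Rmin_l _ _)).
  assert (sd2 := Rlt_le_trans _ _ _ sd (Rmin_r _ _)).
  assert (Hs : 0 <= s) by lra; destruct Ht as [t0 t1].
  assert (F := sg_closed I T H s f Hs Hf); assert (G := sg_closed I T H s g Hs Hg).
  assert (L1 := inCI_lin I (RtoC 1) (RtoC (- s)) _ _ F G).
  assert (L2 := inCI_lin I (RtoC 1) (RtoC (-1)) _ _ L1 Hf).
  assert (B : leCI I (fun x => RtoC 1 * (RtoC 1 * T s f x + RtoC (- s) * T s g x) + RtoC (-1) * f x)%C
     (2 * s * eps)).
  { intros y Iy.
    assert (NZ : RtoC s <> RtoC 0) by (intros K; apply RtoC_inj in K; lra).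
    replace (_ + _)%C with
      (RtoC s * (((T s f y - f y) / RtoC s - g y) + - (T s g y - g y)))%C.
    - rewrite Cmod_mult, Cmod_R, Rabs_pos_eq by exact Hs.
      replace (2 * s * eps) with (s * (eps + eps)) by ring.
      apply Rmult_le_compat_l; [exact Hs|].
      eapply Rle_trans; [apply Cmod_triangle|]; rewrite Cmod_opp.
      apply Rplus_le_compat; [apply (Hd s (conj s0 sd1) y Iy)|apply (Hd' s (conj s0 sd2) y Iy)].
    - rewrite RtoC_m1, RtoC_opp; field; exact NZ. }
  assert (Q := HM t (conj t0 t1) _ _ L2 B x Ix); cbv beta in Q.
  rewrite (op_linear_sub I (T t) _ _ (sg_op_linear I T t H t0) L1 Hf x Ix) in Q.
  rewrite (sg_linear I T H t _ _ _ _ t0 F G x Ix) in Q.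
  rewrite (sg_add I T H t s f t0 Hs Hf x Ix), (sg_add I T H t s g t0 Hs Hg x Ix).
  replace (T t (T s f) x - RtoC s * T t (T s g) x - T t f x)%C
    with (RtoC 1 * T t (T s f) x + RtoC (- s) * T t (T s g) x - T t f x)%C; [exact Q|].
  rewrite RtoC_opp; ring.
Qed.

(** By [1 + 2x <= exp (2x)], since [(1 - x)(1 + 2x) = 1 + x (1 - 2x)]. *)
Lemma one_le_backward_factor x : 0 <= x <= / 2 -> 1 <= (1 - x) * exp (2 * x).
Proof.
  intros Hx; assert (E := exp_ineq1_le (2 * x)); nra.
Qed.

(* Backward Euler: [(1 - s L) |T(t+s) f| <= |T(t) f| + o(s)] uniformly in [t],
   iterated over steps of length [t/n]. *)
Lemma quasi_dissipative_growth a b T L f g U t : a <= b -> C0_semigroup (Icc a b) T ->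
  0 <= L ->
  (forall v w s B, generator (Icc a b) T v w -> 0 <= s ->
     leCI (Icc a b) (fun x => v x - RtoC s * w x)%C B ->
     forall x, Icc a b x -> (1 - s * L) * Cmod (v x) <= B) ->
  generator (Icc a b) T f g -> leCI (Icc a b) f U -> 0 <= t ->
  leCI (Icc a b) (T t f) (exp (2 * L * t) * (U + 1)).
Proof.
  intros ab H L0 HD Hfg HU t0.
  set (I := Icc a b) in *.
  assert (I0 : I a) by (split; lra).
  assert (Hf : inCI I f) by apply Hfg.
  assert (U0 : 0 <= U) by (apply Rle_trans with (Cmod (f a)); [apply Cmod_ge_0|apply HU; auto]).
  destruct (semigroup_locally_bounded a b T t ab H) as [M [M0 HM]]; fold I in HM.
  (* Chosen so that the defect [M (2 s eps)] of one step is exactly [s / (t + 1)]; over all steps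
     this adds up to [t / (t + 1) <= 1], the source of [U + 1]. *)
  pose (eps := / (2 * M * (t + 1))).
  assert (e0 : 0 < eps).
  { apply Rinv_0_lt_compat; apply Rmult_lt_0_compat; lra. }
  destruct (backward_euler_error I T f g M t eps H Hfg e0 HM) as [d [d0 Hd]].
  destruct (Rle_lt_or_eq_dec _ _ t0) as [tp|<-].
  2:{ intros x Ix; rewrite (sg_zero I T H f Hf x Ix), Rmult_0_r, exp_0.
      specialize (HU x Ix); lra. }
  (* [n > t / d] gives a step [s < d], and [n > 2 L t] gives [s L <= 1/2]. *)
  destruct (INR_unbounded (t / d + 2 * L * t)) as [n Hn].
  assert (P1 : 0 < t / d) by (apply Rdiv_lt_0_compat; lra).
  assert (P2 : 0 <= 2 * L * t) by nra.
  assert (n0 : 0 < INR n) by lra.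
  pose (s := t / INR n).
  assert (s0 : 0 < s) by (apply Rdiv_lt_0_compat; lra).
  assert (st : INR n * s = t) by (unfold s; field; lra).
  assert (sd : s < d).
  { apply Rmult_lt_reg_l with (INR n); [exact n0|]; rewrite st.
    replace t with (t / d * d) at 1 by (field; lra).
    apply Rmult_lt_compat_r; lra. }
  assert (sL : 0 <= s * L <= / 2).
  { split; [nra|].
    apply Rmult_le_reg_l with (INR n); [exact n0|].
    rewrite <- Rmult_assoc, st; lra. }
  assert (K : forall j, (j <= n)%nat ->
    leCI I (T (INR j * s) f) (exp (2 * L * (INR j * s)) * (U + INR j * s / (t + 1)))).
  { induction j as [|j IH]; intros Hj.
    - simpl; rewrite Rmult_0_l; unfold Rdiv; rewrite Rmult_0_l, Rmult_0_r, exp_0.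
      intros x Ix; rewrite (sg_zero I T H f Hf x Ix).
      specialize (HU x Ix); lra.
    - specialize (IH ltac:(lia)).
      assert (j0 := pos_INR j).
      assert (jn : INR j * s <= t).
      { rewrite <- st; apply Rmult_le_compat_r; [lra|apply le_INR; lia]. }
      assert (js0 : 0 <= INR j * s) by nra.
      rewrite S_INR; replace ((INR j + 1) * s) with (INR j * s + s) by ring.
      set (r := INR j * s) in *.
      assert (Hr : 0 <= r + s) by lra.
      assert (Hd' := Hd s r (conj s0 sd) (conj js0 jn)).
      (* As the growth factor is at least [1], the additive defect of the new step can be absorbed
         under it. *)
      assert (Ex : 1 <= exp (2 * L * r)).
      { assert (X := exp_ineq1_le (2 * L * r)); nra. }
      assert (D1 : 0 <= s / (t + 1)) by (apply Rdiv_le_0_compat; lra).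
      assert (G : leCI I (fun x => T (r + s)%R f x - RtoC s * T (r + s)%R g x)%C
          (exp (2 * L * r) * (U + (r + s) / (t + 1)))).
      { intros x Ix.
        eapply Rle_trans; [apply (Cmod_sub_le _ (T r f x))|].
        specialize (IH x Ix); specialize (Hd' x Ix).
        replace (M * (2 * s * eps)) with (s / (t + 1)) in Hd'
          by (unfold eps; field; lra).
        replace ((r + s) / (t + 1)) with (r / (t + 1) + s / (t + 1)) by (field; lra).
        nra. }
      intros x Ix.
      assert (Y := HD _ _ s _ (generator_semigroup I T f g (r + s) H Hr Hfg) (Rlt_le _ _ s0) G x Ix).
      assert (Z := one_le_backward_factor (s * L) sL).
      replace (2 * L * (r + s)) with (2 * (s * L) + 2 * L * r) by ring.
      rewrite exp_plus, Rmult_assoc.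
      assert (V := Cmod_ge_0 (T (r + s) f x)).
      assert (W := exp_pos (2 * (s * L))).
      apply Rle_trans with (exp (2 * (s * L)) * ((1 - s * L) * Cmod (T (r + s) f x))); [nra|].
      apply Rmult_le_compat_l; lra. }
  intros x Ix; specialize (K n (le_n _) x Ix); rewrite st in K.
  eapply Rle_trans; [exact K|].
  apply Rmult_le_compat_l; [apply Rlt_le, exp_pos|].
  apply Rplus_le_compat_l; apply Rle_div_l; lra.
Qed.

(** * The Fokker-Planck operator *)

Lemma is_derive_on_derivable_pt_lim a b f x l :
  a < x < b -> rd (Icc a b) f x l -> derivable_pt_lim f x l.
Proof.
  intros Hx H; apply is_derive_Reals; apply (is_derive_on_interior (Icc a b)); [|exact H].
  assert (P : 0 < Rmin (x - a) (b - x)) by (apply Rmin_pos; lra).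
  exists (mkposreal _ P); intros y Hy.
  change (Rabs (y - x) < Rmin (x - a) (b - x)) in Hy.
  assert (h1 := Rmin_l (x - a) (b - x)); assert (h2 := Rmin_r (x - a) (b - x)).
  apply Rabs_lt_between in Hy; split; lra.
Qed.

(** If [l > 0], then [g1], which vanishes at [x], is positive just to the right of it, and the mean
    value theorem makes [g] exceed its maximum. *)
Lemma max_second_derive_le0 a b (g g1 : R -> R) x l :
  a < x < b -> (forall y, Icc a b y -> rd (Icc a b) g y (g1 y)) ->
  rd (Icc a b) g1 x l -> g1 x = 0 ->
  (forall y, Icc a b y -> g y <= g x) -> l <= 0.
Proof.
  intros Hx H1 H2 Z Hm.
  destruct (Rle_dec l 0) as [P|P]; [exact P|exfalso].
  assert (Ix : Icc a b x) by (split; lra).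
  destruct (proj1 (is_derive_on_eps _ g1 x l Ix) H2 (l / 2)) as [d [d0 Hd]]; [lra|].
  assert (h0 : 0 < Rmin (d / 2) ((b - x) / 2)) by (apply Rmin_pos; lra).
  assert (h1 := Rmin_l (d / 2) ((b - x) / 2)).
  assert (h2 := Rmin_r (d / 2) ((b - x) / 2)).
  set (h := Rmin (d / 2) ((b - x) / 2)) in *.
  destruct (MVT_cor2 g g1 x (x + h)) as [c [E Hc]]; [lra| |].
  { intros c Hc; apply (is_derive_on_derivable_pt_lim a b); [lra|].
    apply H1; split; lra. }
  assert (Hc' := Hd c ltac:(split; lra) ltac:(rewrite Rabs_pos_eq; lra)).
  rewrite Z, (Rabs_pos_eq (c - x)) in Hc' by lra.
  apply Rabs_le_between in Hc'.
  assert (Hy := Hm (x + h) ltac:(split; lra)).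
  assert (0 < g1 c) by nra.
  nra.
Qed.

Lemma dotC_plus w x y : dotC w (x + y)%C = dotC w x + dotC w y.
Proof. unfold dotC; simpl; ring. Qed.

Lemma dotC_minus w x y : dotC w (x - y)%C = dotC w x - dotC w y.
Proof. unfold dotC; simpl; ring. Qed.

Lemma dotC_scal w r x : dotC w (RtoC r * x)%C = r * dotC w x.
Proof. unfold dotC; simpl; ring. Qed.

Section FokkerPlanck.
Variables (A Cf : R -> R) (N : nat) (L : R) (B1 B2 D1 : R -> R).
Let h := half_step N.
Let I := INh N.
Let k := 1 / (2 * INR N).
Hypothesis N0 : (0 < N)%nat.
Hypothesis HB : forall x, I x -> rd I (fun y => A y + Cf y) x (B1 x).
Hypothesis HB1 : forall x, I x -> rd I B1 x (B2 x).
Hypothesis HD : forall x, I x -> rd I (fun y => A y - Cf y) x (D1 x).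
Hypothesis Bpos : forall x, I x -> 0 < A x + Cf x.
(** The quantity bounded here is the zeroth order coefficient of the expanded operator. The two
    hypotheses after it fix the sign of the drift in the boundary condition. *)
Hypothesis HL : forall x, I x -> k * B2 x - D1 x <= L.
Hypothesis Hleft : k * B1 (- h) < A (- h) - Cf (- h).
Hypothesis Hright : A (1 + h) - Cf (1 + h) < k * B1 (1 + h).

Lemma half_step_pos : 0 < h.
Proof.
  unfold h, half_step; assert (0 < INR N) by (apply lt_0_INR; exact N0).
  apply Rdiv_lt_0_compat; lra.
Qed.

Lemma CDerive_on_sumf (v v1 : cfun) x : I x -> cd I v x (v1 x) ->
  CDerive_on I (sumf A Cf v) x = (RtoC (B1 x) * v x + RtoC (A x + Cf x) * v1 x)%C.
Proof.
  intros Ix Hv; assert (hp := half_step_pos).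
  apply CDerive_on_correct; [fold h; lra|exact Ix|].
  apply (is_derive_on_RtoC_mult I (fun y => A y + Cf y)); auto.
Qed.

Lemma FP_op_eq (v v1 v2 : cfun) :
  (forall x, I x -> cd I v x (v1 x)) -> (forall x, I x -> cd I v1 x (v2 x)) ->
  forall x, I x -> FP_op A Cf N v x =
    (RtoC k * ((RtoC (B2 x) * v x + RtoC (B1 x) * v1 x)
               + (RtoC (B1 x) * v1 x + RtoC (A x + Cf x) * v2 x))
     - (RtoC (D1 x) * v x + RtoC (A x - Cf x) * v1 x))%C.
Proof.
  intros Hv Hv1 x Ix; assert (hp := half_step_pos); unfold FP_op.
  f_equal; [f_equal|f_equal].
  - apply CDerive_on_correct; [fold h; lra|exact Ix|].
    (* The inner derivative has to be replaced by its formula on all of [I] before the outer one is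
       evaluated. *)
    apply (is_derive_on_ext I
      (fun y => (RtoC (B1 y) * v y + RtoC (A y + Cf y) * v1 y)%C) _ _ _ Ix).
    { intros y Iy; symmetry; apply CDerive_on_sumf; auto. }
    apply is_derive_on_C_plus; [exact Ix| |].
    + apply is_derive_on_RtoC_mult; auto.
    + apply (is_derive_on_RtoC_mult I (fun y => A y + Cf y)); auto.
  - apply CDerive_on_correct; [fold h; lra|exact Ix|].
    apply (is_derive_on_RtoC_mult I (fun y => A y - Cf y)); auto.
Qed.

(* With [x0] a maximum point of [|v|] and [g = Re (conj (v x0) v)], the real
   function [g] is maximal at [x0]; the boundary condition gives
   [k (A + C) g' = ((A - C) - k (A + C)') g] at the end-points, where the sign
   of the bracket forbids a positive maximum, so [g' = 0 >= g''] at [x0]. *)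
Lemma FP_op_max_point v x0 : FP_dom A Cf N v -> I x0 -> 0 < Cmod (v x0) ->
  (forall x, I x -> Cmod (v x) <= Cmod (v x0)) ->
  dotC (v x0) (FP_op A Cf N v x0) <= L * Cmod (v x0) ^ 2.
Proof.
  intros [[v1 [Hv [v2 [Hv1 _]]]] Hbc] Ix0 m0 Hmax.
  assert (hp := half_step_pos).
  set (w := v x0) in *.
  pose (g := fun x => dotC w (v x)); pose (g1 := fun x => dotC w (v1 x)).
  assert (Hg : forall x, I x -> rd I g x (g1 x)) by (intros; apply is_derive_on_dotC; auto).
  assert (Hg1 : rd I g1 x0 (dotC w (v2 x0))) by (apply is_derive_on_dotC; auto).
  assert (G0 : g x0 = Cmod w ^ 2) by apply dotC_self.
  assert (gmax : forall x, I x -> g x <= g x0).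
  { intros x Ix; rewrite G0; unfold g; eapply Rle_trans; [apply dotC_le|].
    specialize (Hmax x Ix); simpl; nra. }
  assert (gpos : 0 < g x0) by (rewrite G0; nra).
  (* The diffusion coefficient [k] and the half step [h] are the same number [1 / (2N)]. *)
  assert (kp : 0 < k) by exact hp.
  assert (BC : forall z, z = - h \/ z = 1 + h -> I z ->
     k * ((A z + Cf z) * g1 z) = (A z - Cf z - k * B1 z) * g z).
  { intros z Hz Iz; generalize (Hbc z Hz).
    assert (E := CDerive_on_sumf v v1 z Iz (Hv z Iz)); unfold I in E; rewrite E.
    intros K; apply (f_equal (dotC w)) in K.
    unfold difff in K; fold k in K.
    rewrite dotC_minus, dotC_scal, dotC_plus, !dotC_scal in K.
    replace (dotC w (RtoC 0)) with 0 in K by (unfold dotC; simpl; ring).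
    fold (g z) in K; fold (g1 z) in K; lra. }
  assert (NL : x0 <> - h).
  { intros E.
    assert (X := max_derive_le0 (- h) (1 + h) g x0 (g1 x0) ltac:(lra) Ix0 (Hg x0 Ix0) gmax).
    assert (Y := BC x0 (or_introl E) Ix0); assert (Z := Bpos x0 Ix0).
    assert (0 < A x0 - Cf x0 - k * B1 x0) by (rewrite E; lra).
    assert (0 < (A x0 - Cf x0 - k * B1 x0) * g x0) by (apply Rmult_lt_0_compat; auto).
    assert (0 < k * (A x0 + Cf x0)) by (apply Rmult_lt_0_compat; auto).
    nra. }
  assert (NR : x0 <> 1 + h).
  { intros E.
    assert (X := max_derive_ge0 (- h) (1 + h) g x0 (g1 x0) ltac:(lra) Ix0 (Hg x0 Ix0) gmax).
    assert (Y := BC x0 (or_intror E) Ix0); assert (Z := Bpos x0 Ix0).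
    assert (0 < - (A x0 - Cf x0 - k * B1 x0)) by (rewrite E; lra).
    assert (0 < - (A x0 - Cf x0 - k * B1 x0) * g x0) by (apply Rmult_lt_0_compat; auto).
    assert (0 < k * (A x0 + Cf x0)) by (apply Rmult_lt_0_compat; auto).
    nra. }
  assert (Int : - h < x0 < 1 + h).
  { destruct Ix0 as [P Q]; fold h in P, Q; split; lra. }
  assert (Z1 : g1 x0 = 0).
  { apply Rle_antisym.
    - apply (max_derive_le0 (- h) (1 + h) g x0); auto; lra.
    - apply (max_derive_ge0 (- h) (1 + h) g x0); auto; lra. }
  assert (Z2 := max_second_derive_le0 (- h) (1 + h) g g1 x0 _ Int Hg Hg1 Z1 gmax).
  rewrite (FP_op_eq v v1 v2 Hv Hv1 x0 Ix0).
  rewrite dotC_minus, dotC_scal, !dotC_plus, !dotC_scal.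
  fold (g x0); fold (g1 x0); rewrite Z1, <- G0.
  assert (HL0 := HL x0 Ix0); assert (HB0 := Bpos x0 Ix0).
  assert (0 <= k * ((A x0 + Cf x0) * - dotC w (v2 x0))).
  { apply Rmult_le_pos; [lra|]; apply Rmult_le_pos; lra. }
  nra.
Qed.

(** At a maximum point [x0] of [|v|], pairing [v - s w] with [v x0] gives
    [(1 - s L) |v x0|^2 <= |v x0| B]. *)
Lemma FP_op_quasi_dissipative v w s B : FP_dom A Cf N v -> eqCI I w (FP_op A Cf N v) ->
  0 <= s -> leCI I (fun x => v x - RtoC s * w x)%C B ->
  forall x, I x -> (1 - s * L) * Cmod (v x) <= B.
Proof.
  intros Hv Hw s0 HBd x Ix.
  assert (hp := half_step_pos).
  assert (Cv : inCI I v) by (apply (class_C_continuous 2 I v); apply Hv).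
  destruct (continuous_on_max (- h) (1 + h) (fun x => Cmod (v x))) as [x0 [Ix0 Hmax]].
  { lra. } { apply inCI_Cmod; exact Cv. }
  assert (X := HBd x0 Ix0); cbv beta in X.
  assert (B0 : 0 <= B) by (eapply Rle_trans; [apply Cmod_ge_0|exact X]).
  assert (M0 := Cmod_ge_0 (v x0)).
  assert (K : (1 - s * L) * Cmod (v x0) <= B).
  { destruct (Rle_lt_or_eq_dec _ _ M0) as [P|P].
    - assert (Y := FP_op_max_point v x0 Hv Ix0 P Hmax).
      assert (Z := dotC_le (v x0) (v x0 - RtoC s * w x0)%C).
      rewrite dotC_minus, dotC_scal, dotC_self, (Hw x0 Ix0) in Z.
      rewrite (Hw x0 Ix0) in X.
      apply Rmult_le_reg_l with (1 := P).
      assert (s * dotC (v x0) (FP_op A Cf N v x0) <= s * (L * Cmod (v x0) ^ 2))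
        by (apply Rmult_le_compat_l; auto).
      assert (Cmod (v x0) * Cmod (v x0 - RtoC s * FP_op A Cf N v x0)%C <= Cmod (v x0) * B)
        by (apply Rmult_le_compat_l; auto).
      nra.
    - rewrite <- P; lra. }
  specialize (Hmax x Ix); simpl in Hmax.
  assert (V := Cmod_ge_0 (v x)).
  (* For [1 - s L >= 0] the bound at the maximum dominates; otherwise the left side is at most
     [0 <= B]. *)
  destruct (Rle_dec 0 (1 - s * L)); nra.
Qed.
End FokkerPlanck.

(** * The initial datum, the rates and the uniform constant *)

Lemma class_C_RtoC n (D : R -> Prop) (f : R -> R) :
  Rclass_C n D f -> Cclass_C n D (fun x => RtoC (f x)).
Proof.
  revert f; induction n as [|n IH]; intros f H.
  - apply inCI_eps; intros x eps Dx e0.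
    destruct (proj1 (filterlim_locally (F := within D (locally x)) _ _) (H x Dx)
      (mkposreal eps e0)) as [d Hd].
    exists d; split; [apply cond_pos|]; intros y Dy Hy.
    rewrite <- RtoC_minus, Cmod_R; exact (Hd y Hy Dy).
  - destruct H as [f' [H1 H2]]; exists (fun x => RtoC (f' x)); split; [|apply IH; exact H2].
    intros x Dx; apply is_derive_on_C; split; [apply H1; exact Dx|apply (is_derive_on_const D 0 x)].
Qed.

Lemma ext0_outside u x : x < 0 \/ 1 < x -> ext0 u x = 0.
Proof.
  intros H; unfold ext0; destruct (Rle_dec 0 x); auto; destruct (Rle_dec x 1); auto; lra.
Qed.

(** The extension vanishes within distance [h] of either end-point, since such points lie outside
    [[0, 1]]; both terms of the boundary condition are therefore zero. *)
Lemma FP_dom_ext0 A Cf N u : (0 < N)%nat -> Rclass_C 2 (INh N) (ext0 u) ->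
  FP_dom A Cf N (fun x => RtoC (ext0 u x)).
Proof.
  intros N0 H; split; [apply (class_C_RtoC 2); exact H|].
  assert (hp := half_step_pos N N0).
  intros z Hz.
  assert (Iz : INh N z) by (unfold INh, Icc; lra).
  assert (E : forall y, Rabs (y - z) < half_step N -> ext0 u y = 0).
  { intros y Hy; apply Rabs_lt_between in Hy; apply ext0_outside; lra. }
  assert (E0 : ext0 u z = 0) by (apply E; unfold Rminus; rewrite Rplus_opp_r, Rabs_R0; exact hp).
  unfold difff; rewrite E0.
  assert (Dz : CDerive_on (INh N) (sumf A Cf (fun x => RtoC (ext0 u x))) z = RtoC 0).
  { apply CDerive_on_correct; [lra|exact Iz|].
    apply is_derive_on_C; split; apply is_derive_on_eps; auto;
      intros eps e0; exists (half_step N); split; auto; intros y _ Hy;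
      unfold sumf; rewrite E0, (E y Hy); simpl;
      match goal with |- Rabs ?a <= _ => replace a with 0 by ring end;
      rewrite Rabs_R0; apply Rmult_le_pos; [lra|apply Rabs_pos|lra|apply Rabs_pos]. }
  rewrite Dz; ring.
Qed.

(** By the mean value theorem the factor [N] in the rate cancels the mesh width [1/N], so the bound
    does not depend on [N]. *)
Lemma rate_increment F F1 M N j : (j < N)%nat ->
  (forall x, 0 <= x <= 1 -> derivable_pt_lim F x (F1 x) /\ Rabs (F1 x) <= M) ->
  Rabs (rate F N (S j) - rate F N j) <= M.
Proof.
  intros Hj H.
  assert (n0 : 0 < INR N) by (apply lt_0_INR; lia).
  assert (j0 := pos_INR j).
  assert (jn : INR j + 1 <= INR N) by (rewrite <- S_INR; apply le_INR; lia).
  assert (P0 : 0 <= INR j / INR N) by (apply Rdiv_le_0_compat; lra).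
  assert (P1 : (INR j + 1) / INR N <= 1) by (apply Rle_div_l; lra).
  assert (P2 : (INR j + 1) / INR N = INR j / INR N + / INR N) by (field; lra).
  assert (i0 := Rinv_0_lt_compat _ n0).
  destruct (MVT_cor2 F F1 (INR j / INR N) ((INR j + 1) / INR N)) as [c [E Hc]]; [lra| |].
  { intros c Hc; apply H; lra. }
  unfold rate; rewrite S_INR, <- Rmult_minus_distr_l, E, P2.
  replace (INR N * (F1 c * (INR j / INR N + / INR N - INR j / INR N))) with (F1 c)
    by (field; lra).
  apply H; lra.
Qed.

Theorem theorem3
  (eta : R) (A Cf : R -> R) (N0 : nat) (u0 : R -> R)
  (T : nat -> R -> cfun -> cfun) (q : nat -> nat -> R -> R)
  (eta_pos : 0 < eta)
  (A_C4 : Rclass_C 4 (Icc (- eta) (1 + eta)) A)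
  (Cf_C4 : Rclass_C 4 (Icc (- eta) (1 + eta)) Cf)
  (A_ge0 : forall x, 0 <= x <= 1 -> 0 <= A x)
  (Cf_ge0 : forall x, 0 <= x <= 1 -> 0 <= Cf x)
  (AC_pos : forall x, - eta <= x <= 1 + eta -> 0 < A x + Cf x)
  (A1 : A 1 = 0)
  (Cf0 : Cf 0 = 0)
  (AC_left : forall x, - eta <= x <= 0 -> 0 < A x - Cf x)
  (AC_right : forall x, 1 <= x <= 1 + eta -> A x - Cf x < 0)
  (N0_pos : (0 < N0)%nat)
  (N0_eta : 1 / (2 * eta) < INR N0)
  (N0_deriv : forall x, - eta <= x <= 0 \/ 1 <= x <= 1 + eta ->
     Rabs (RDerive_on (Icc (- eta) (1 + eta)) A x
           + RDerive_on (Icc (- eta) (1 + eta)) Cf x)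
     < 2 * INR N0 * Rabs (A x - Cf x))
  (u0_C2 : Rclass_C 2 (Icc 0 1) u0)
  (u0_ge0 : forall x, 0 <= x <= 1 -> 0 <= u0 x)
  (u0_0 : u0 0 = 0)
  (u0'_0 : RDerive_on (Icc 0 1) u0 0 = 0)
  (u0_1 : u0 1 = 0)
  (u0'_1 : RDerive_on (Icc 0 1) u0 1 = 0)
  (u0N_C2 : forall N : nat, (N0 < N)%nat -> Rclass_C 2 (INh N) (ext0 u0))
  (T_FP : forall N : nat, (N0 < N)%nat -> FP_semigroup A Cf N (T N))
  (q_sol : forall N : nat, (N0 < N)%nat -> master_solution A Cf N u0 (q N)) :
  forall t0 : R, 0 < t0 ->
  exists K : R,
    forall (t : R) (k N : nat),
      0 <= t <= t0 -> (k <= N)%nat -> (N0 < N)%nat ->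
      Cmod (T N t (fun x => RtoC (ext0 u0 x)) (INR k / INR N)%R
            - RtoC (q N k t))%C <= K.
Proof.
  intros t0 t0_pos.
  set (J := Icc (- eta) (1 + eta)) in *.
  assert (HA : exists a1 a2, (forall x, J x -> rd J A x (a1 x)) /\
     (forall x, J x -> rd J a1 x (a2 x)) /\ continuous_on J a1 /\ continuous_on J a2).
  { destruct A_C4 as [a1 [H1 K1]]; assert (K1' := class_C_continuous 3 _ _ K1).
    destruct K1 as [a2 [H2 K2]]; assert (K2' := class_C_continuous 2 _ _ K2).
    exists a1, a2; auto. }
  assert (HC : exists c1 c2, (forall x, J x -> rd J Cf x (c1 x)) /\
     (forall x, J x -> rd J c1 x (c2 x)) /\ continuous_on J c1 /\ continuous_on J c2).
  { destruct Cf_C4 as [c1 [H1 K1]]; assert (K1' := class_C_continuous 3 _ _ K1).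
    destruct K1 as [c2 [H2 K2]]; assert (K2' := class_C_continuous 2 _ _ K2).
    exists c1, c2; auto. }
  destruct HA as [a1 [a2 [Ha1 [Ha2 [Ka1 Ka2]]]]], HC as [c1 [c2 [Hc1 [Hc2 [Kc1 Kc2]]]]].
  assert (ab : - eta <= 1 + eta) by lra.
  destruct (continuous_on_bounded _ _ a1 ab Ka1) as [Ma1 [Pa1 Ba1]].
  destruct (continuous_on_bounded _ _ a2 ab Ka2) as [Ma2 [Pa2 Ba2]].
  destruct (continuous_on_bounded _ _ c1 ab Kc1) as [Mc1 [Pc1 Bc1]].
  destruct (continuous_on_bounded _ _ c2 ab Kc2) as [Mc2 [Pc2 Bc2]].
  destruct (continuous_on_bounded 0 1 u0 Rle_0_1 (class_C_continuous 2 _ _ u0_C2)) as [U [U0 HU]].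
  (* One constant for both halves: it dominates the increments of the rates and, because
     [1 / (2N) <= 1], the zeroth order coefficient of the operator. *)
  pose (L := Ma1 + Ma2 + Mc1 + Mc2).
  assert (L0 : 0 <= L) by (unfold L; lra).
  exists (exp (2 * L * t0) * (U + 1) + U * exp ((2 * L + 1) * t0)).
  intros t k N Ht Hk HN.
  assert (Np : (0 < N)%nat) by lia.
  assert (n0 : 0 < INR N) by (apply lt_0_INR; exact Np).
  assert (NN0 : INR N0 < INR N) by (apply lt_INR; exact HN).
  assert (n00 : 0 < INR N0) by (apply lt_0_INR; exact N0_pos).
  assert (n1 : 1 <= INR N) by (apply (le_INR 1); lia).
  assert (hp := half_step_pos N Np).
  assert (h_eta : half_step N < eta).
  (* From [N > N0 > 1 / (2 eta)]; thus [[-h, 1 + h]] lies where the coefficients are controlled. *)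
  { unfold half_step; apply Rlt_div_l; [lra|].
    apply (Rlt_div_l 1) in N0_eta; [|lra]; nra. }
  assert (Sub : forall x, INh N x -> J x).
  { intros x [P Q]; unfold J; split; lra. }
  assert (kle : 0 < half_step N <= 1).
  { split; [exact hp|unfold half_step; apply Rle_div_l; lra]. }
  assert (Ex : forall c s, 0 <= c -> 0 <= s <= t0 -> exp (c * s) <= exp (c * t0)).
  { intros c s Hc Hs; destruct (Rle_lt_or_eq_dec (c * s) (c * t0)) as [P| ->].
    - apply Rmult_le_compat_l; lra.
    - apply Rlt_le, exp_increasing, P.
    - lra. }
  eapply Rle_trans; [apply Cmod_triangle|]; rewrite Cmod_opp, Cmod_R.
  apply Rplus_le_compat.
  - destruct (T_FP N HN) as [HT Hgen].
    pose (f := fun x => RtoC (ext0 u0 x)).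
    assert (Hdom := FP_dom_ext0 A Cf N u0 Np (u0N_C2 N HN)); fold f in Hdom.
    assert (Hfg : generator (INh N) (T N) f (FP_op A Cf N f)).
    { apply Hgen; split; [exact Hdom|intros x _; reflexivity]. }
    (* The condition imposed on [N0] persists for larger [N], because its right side grows with
       [N]. *)
    assert (Bd : forall z, - eta <= z <= 0 \/ 1 <= z <= 1 + eta ->
       Rabs (a1 z + c1 z) < 2 * INR N * Rabs (A z - Cf z)).
    { intros z Hz.
      assert (Jz : J z) by (unfold J, Icc; lra).
      assert (K := N0_deriv z Hz); unfold J in K.
      rewrite (RDerive_on_correct (- eta) (1 + eta) A z (a1 z)) in K by (auto; lra).
      rewrite (RDerive_on_correct (- eta) (1 + eta) Cf z (c1 z)) in K by (auto; lra).
      assert (Z := Rabs_pos (A z - Cf z)); nra. }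
    assert (Hdiss := FP_op_quasi_dissipative A Cf N L (fun x => a1 x + c1 x)
      (fun x => a2 x + c2 x) (fun x => a1 x - c1 x) Np).
    assert (G : leCI (INh N) (T N t f) (exp (2 * L * t) * (U + 1))).
    { apply (quasi_dissipative_growth (- half_step N) (1 + half_step N) (T N) L f
        (FP_op A Cf N f) U t ltac:(lra) HT L0); [|exact Hfg| |apply Ht].
      - intros v w s B Hvw; destruct (proj1 (Hgen v w) Hvw) as [Hv Hw].
        apply Hdiss; auto.
        + intros x Ix; apply is_derive_on_plus;
            apply (is_derive_on_subset J); auto.
        + intros x Ix; apply is_derive_on_plus;
            apply (is_derive_on_subset J); auto.
        + intros x Ix.
          apply (is_derive_on_ext _ (fun y => A y + (-1) * Cf y)); [exact Ix|intros y _; simpl; ring|].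
          replace (a1 x - c1 x) with (a1 x + (-1) * c1 x) by ring.
          apply is_derive_on_plus; [|apply is_derive_on_scal; [exact Ix|]];
            apply (is_derive_on_subset J); auto.
        + intros x Ix; apply AC_pos; apply (Sub x Ix).
        + intros x Ix; assert (Jx := Sub x Ix).
          change (half_step N * (a2 x + c2 x) - (a1 x - c1 x) <= L).
          assert (X1 := Ba1 x Jx); assert (X2 := Ba2 x Jx).
          assert (X3 := Bc1 x Jx); assert (X4 := Bc2 x Jx).
          apply Rabs_le_between in X1, X2, X3, X4.
          unfold L; nra.
        (* The inequality is [Bd] at [-h] divided by [2N]. The absolute value opens with a plus
           sign, as [A - C] is positive there; at [1 + h] the sign is reversed. *)
        + assert (X := Bd (- half_step N) ltac:(lra)).
          assert (Y := AC_left (- half_step N) ltac:(lra)).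
          rewrite (Rabs_pos_eq (A _ - _)) in X by lra.
          apply Rabs_lt_between in X.
          apply Rmult_lt_reg_l with (2 * INR N); [lra|].
          rewrite <- Rmult_assoc; replace (2 * INR N * (1 / (2 * INR N))) with 1 by (field; lra).
          lra.
        + assert (X := Bd (1 + half_step N) ltac:(lra)).
          assert (Y := AC_right (1 + half_step N) ltac:(lra)).
          rewrite (Rabs_left (A _ - _)) in X by lra.
          apply Rabs_lt_between in X.
          apply Rmult_lt_reg_l with (2 * INR N); [lra|].
          rewrite <- Rmult_assoc; replace (2 * INR N * (1 / (2 * INR N))) with 1 by (field; lra).
          lra.
      - intros x _; unfold f; rewrite Cmod_R; unfold ext0.
        destruct (Rle_dec 0 x); [destruct (Rle_dec x 1)|]; [apply HU; split; auto| |];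
          rewrite Rabs_R0; exact U0. }
    apply Rle_trans with (exp (2 * L * t) * (U + 1)).
    + apply G.
      assert (k0 := pos_INR k); assert (kn := le_INR _ _ Hk).
      assert (0 <= INR k / INR N) by (apply Rdiv_le_0_compat; lra).
      assert (INR k / INR N <= 1) by (apply Rle_div_l; lra).
      split; lra.
    + apply Rmult_le_compat_r; [lra|apply Ex; [lra|exact Ht]].
  - assert (In01 : forall j, (j <= N)%nat -> 0 <= INR j / INR N <= 1).
    { intros j Hj; assert (j0 := pos_INR j); assert (jn := le_INR _ _ Hj).
      split; [apply Rdiv_le_0_compat; lra|apply Rle_div_l; lra]. }
    apply Rle_trans with (U * exp ((2 * L + 1) * t)).
    + apply (master_bound A Cf N L L0) with (u0 := u0); auto; try apply Ht.
      * intros j Hj; unfold rate; apply Rmult_le_pos; [lra|apply A_ge0; auto].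
      * intros j Hj; unfold rate; apply Rmult_le_pos; [lra|apply Cf_ge0; auto].
      * intros j Hj; assert (X := rate_increment A a1 Ma1 N j Hj).
        apply Rabs_le_between in X; [unfold L; lra|].
        intros x Hx; assert (Jx : J x) by (unfold J, Icc; lra).
        split; [|auto].
        apply (is_derive_on_derivable_pt_lim (- eta) (1 + eta)); [lra|auto].
      * intros j Hj; assert (X := rate_increment Cf c1 Mc1 N j Hj).
        apply Rabs_le_between in X; [unfold L; lra|].
        intros x Hx; assert (Jx : J x) by (unfold J, Icc; lra).
        split; [|auto].
        apply (is_derive_on_derivable_pt_lim (- eta) (1 + eta)); [lra|auto].
    + apply Rmult_le_compat_l; [exact U0|apply Ex; [lra|exact Ht]].
Qed.
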